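(* Let $\{\sigma_i : i\in\Lambda\}$ and $\{\sigma'_i : i\in\Lambda\}$ be two isomorphic saturated semibranching function systems satisfying condition (C-K), defined on probability measure spaces $(X,m)$ and $(X',m')$ respectively, with coding maps $\sigma : X\to X$ and $\sigma' : X'\to X'$. Let $T_i$ and $T'_i$ ($i\in\Lambda$) be the operators acting on $L^2(X,m)$ and $L^2(X',m')$, respectively, by $$(T_i\psi)(x)=\chi_{R_i}(x)\,\rho_m(\sigma(x),\sigma_i)^{-1/2}\,\psi(\sigma(x)),\qquad \psi\in L^2(X,m),$$ $$(T'_i\xi)(x)=\chi_{R'_i}(x)\,\rho_{m'}(\sigma'(x),\sigma'_i)^{-1/2}\,\xi(\sigma'(x)),\qquad \xi\in L^2(X',m').$$ Let $\widetilde A$ be the $0$-$1$ matrix defined by condition (C-K) (it is the same for both systems). Then the representations $\pi$ and $\pi'$ of the Cuntz-Krieger algebra $\mathcal O_{\widetilde A}$ determined by $\{T_i : i\in\Lambda\}$ and $\{T'_i : i\in\Lambda\}$, respectively, are unitarily equivalent; that is, there is a unitary $U:L^2(X',m')\to L^2(X,m)$ with $UT'_i=T_iU$ for all $i\in\Lambda$.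
   Context: All relations between sets, maps and functions on a measure space are understood modulo sets of measure zero. Semibranching function system (s.f.s.). Let $(X,m)$ be a probability space with $m$ non-atomic. A finite family $\{\sigma_i:i\in\Lambda\}$ of one-to-one measurable maps $\sigma_i$, with $\sigma_i$ defined on a measurable $D_i\subset X$ and with (measurable) range $R_i=\sigma_i(D_i)$, is an s.f.s. if: (i) $m(R_i\cap R_j)=0$ for $i\ne j$ and $m(X\setminus\bigcup_i R_i)=0$; (ii) $m\circ\sigma_i\ll m$ on $D_i$ (where $(m\circ\sigma_i)(C)=m(\sigma_i(C))$) and $\rho_m(x,\sigma_i):=\frac{d\,m\circ\sigma_i}{dm}(x)>0$ for $m$-a.e. $x\in D_i$; (iii) there is a measurable map $\sigma:X\to X$ (the coding map) with $\sigma\circ\sigma_i(x)=x$ for $m$-a.e. $x\in D_i$, for every $i\in\Lambda$. It is saturated if $\bigcup_i D_i=X$ a.e. A saturated s.f.s. satisfies condition (C-K) if for each $i$ there is $\Lambda_i\subset\Lambda$ with $D_i=\bigcup_{j\in\Lambda_i}R_j$ a.e.; it then defines the $0$-$1$ matrix $\widetilde A=(\widetilde a_{i,j})_{i,j\in\Lambda}$ by $\widetilde a_{i,j}=1\iff j\in\Lambda_i$. Isomorphic s.f.s. Two such systems $\{\sigma_i:D_i\to R_i\}$ on $(X,m)$ and $\{\sigma'_i:D'_i\to R'_i\}$ on $(X',m')$, with the same index set $\Lambda$, are isomorphic if there are measurable maps $\varphi_i$ on $R_i$, $i\in\Lambda$, such that for all $i$: (a) $\varphi_i:R_i\to R'_i$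 is one-to-one and onto; (b) $m'\circ\varphi_i|_{R_i}$ is equivalent to $m|_{R_i}$; (c) $\varphi_i\circ\sigma_i(x)=\sigma'_i\circ\Phi_i(x)$ for $x\in D_i$, where $\Phi_i:D_i\to D'_i$ is defined by $\Phi_i(x)=\varphi_j(x)$ for $x\in R_j$, $j\in\Lambda_i$. Cuntz-Krieger algebra. For a $0$-$1$ matrix $A=(a_{i,j})$, $\mathcal O_A$ is the $C^*$-algebra generated by partial isometries $S_i$ with $\sum_i S_iS_i^*=1$ and $S_i^*S_i=\sum_j a_{i,j}S_jS_j^*$. A family of operators on a Hilbert space satisfying these relations determines a representation of $\mathcal O_A$; operators $T_i$ given by the displayed formula satisfy them for $\widetilde A$. *)

(* Defs.v *)
From HB Require Import structures.
From mathcomp Require Import all_boot all_order all_algebra.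
From mathcomp Require Import complex ring.
From mathcomp Require Import all_classical all_reals all_analysis.
From mathcomp Require Import measurable_realfun.

Set Implicit Arguments.
Unset Strict Implicit.
Unset Printing Implicit Defensive.

Import Order.TTheory GRing.Theory Num.Theory.
Import numFieldNormedType.Exports.

Local Open Scope classical_set_scope.
Local Open Scope ring_scope.
Local Open Scope quotient_scope.

Section ComplexL2.
Context {d : measure_display} {X : measurableType d} {R : realType}.
Variable mu : {measure set X -> \bar R}.
Local Notation C := R[i].

Definition cnormsq (z : C) : R := complex.Re z ^+ 2 + complex.Im z ^+ 2.

Definition cmeasurable (f : X -> C) : Prop :=
  measurable_fun setT (fun x => complex.Re (f x)) /\
  measurable_fun setT (fun x => complex.Im (f x)).

Definition sq_integrable (f : X -> C) : Prop :=
  cmeasurable f /\ (\int[mu]_x (cnormsq (f x))%:E < +oo)%E.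

Definition sqintb : {pred X -> C} := fun f => `[< sq_integrable f >].

Lemma cnormsq_ge0 z : 0 <= cnormsq z.
Proof. by rewrite addr_ge0// sqr_ge0. Qed.

Lemma cnormsqD z w : cnormsq (z + w) <= 2 * cnormsq z + 2 * cnormsq w.
Proof.
case: z => a b; case: w => c e; rewrite /cnormsq /=.
have ineq (u v : R) : (u + v) ^+ 2 <= 2 * u ^+ 2 + 2 * v ^+ 2.
  rewrite -subr_ge0 (_ : _ - _ = (u - v) ^+ 2) ?sqr_ge0//.
  by rewrite sqrrD sqrrB !mulr_natl !mulr2n; ring.
apply: (le_trans (lerD (ineq a c) (ineq b e))).
by rewrite le_eqVlt; apply/orP; left; apply/eqP; ring.
Qed.

Lemma cnormsqM z w : cnormsq (z * w) = cnormsq z * cnormsq w.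
Proof. by case: z => a b; case: w => c e; rewrite /cnormsq /=; ring. Qed.

Lemma measurable_cnormsq f : cmeasurable f ->
  measurable_fun setT (EFin \o (fun x => cnormsq (f x))).
Proof.
move=> [mr mi]; apply/measurable_EFinP.
by apply: measurable_funD; exact: measurable_funX.
Qed.

Lemma sqintb_submod_closed : submod_closed sqintb.
Proof.
split.
  apply/asboolP; split; first by split; exact: measurable_cst.
  under eq_integral do rewrite /cnormsq /= expr0n addr0.
  by rewrite integral0.
move=> a f g /asboolP[[fr fi] If] /asboolP[[gr gi] Ig].
have mh : cmeasurable (a *: f + g).
  rewrite /cmeasurable; split.
    rewrite (_ : (fun _ => _) = (fun x => complex.Re a * complex.Re (f x)
        - complex.Im a * complex.Im (f x) + complex.Re (g x))); last first.
      apply/funext => x; rewrite /GRing.add /GRing.scale /=.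
      by case: (f x) (g x) a => [? ?] [? ?] [? ?].
    apply: measurable_funD => //; apply: measurable_funB.
      exact: measurable_funM.
    exact: measurable_funM.
  rewrite (_ : (fun _ => _) = (fun x => complex.Re a * complex.Im (f x)
      + complex.Im a * complex.Re (f x) + complex.Im (g x))); last first.
    apply/funext => x; rewrite /GRing.add /GRing.scale /=.
    by case: (f x) (g x) a => [? ?] [? ?] [? ?].
  apply: measurable_funD => //; apply: measurable_funD.
    exact: measurable_funM.
  exact: measurable_funM.
apply/asboolP; split => //.
apply: (@le_lt_trans _ _ (\int[mu]_x ((2 * cnormsq a)%:E * (cnormsq (f x))%:E
    + 2%:E * (cnormsq (g x))%:E))%E).
  apply: ge0_le_integral => //.
  - by move=> x _; rewrite lee_fin cnormsq_ge0.
  - exact: measurable_cnormsq.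
  - by apply: emeasurable_funD; apply: measurable_funeM; exact: measurable_cnormsq.
  - move=> x _; rewrite -!EFinM -EFinD lee_fin.
    apply: le_trans (cnormsqD _ _) _.
    by rewrite (_ : (a *: f) x = a * f x)// cnormsqM mulrA.
rewrite ge0_integralD//; last 4 first.
- by move=> x _; rewrite mule_ge0// lee_fin ?mulr_ge0// cnormsq_ge0.
- by apply: measurable_funeM; exact: measurable_cnormsq.
- by move=> x _; rewrite mule_ge0// lee_fin ?cnormsq_ge0.
- by apply: measurable_funeM; exact: measurable_cnormsq.
rewrite ge0_integralZl//; last 3 first.
- exact: measurable_cnormsq.
- by move=> x _; rewrite lee_fin cnormsq_ge0.
- by rewrite lee_fin mulr_ge0// cnormsq_ge0.
rewrite ge0_integralZl//; last 2 first.
- exact: measurable_cnormsq.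
- by move=> x _; rewrite lee_fin cnormsq_ge0.
by apply: lte_add_pinfty; apply: lte_mul_pinfty;
  rewrite ?lee_fin ?mulr_ge0 ?cnormsq_ge0.
Qed.

HB.instance Definition _ := GRing.isSubmodClosed.Build C (X -> C) sqintb
  sqintb_submod_closed.

Record sqfun := SqFun { sqfun_val :> X -> C ; _ : sqfun_val \in sqintb }.

HB.instance Definition _ := [isSub for sqfun_val].
HB.instance Definition _ := gen_eqMixin sqfun.
HB.instance Definition _ := gen_choiceMixin sqfun.
HB.instance Definition _ := [SubChoice_isSubLmodule of sqfun by <:].

Definition ae_null : {pred sqfun} :=
  fun f => `[< {ae mu, forall x, f x = 0} >].

Lemma ae_null_submod_closed : submod_closed ae_null.
Proof.
split; first by apply/asboolP; exact: aeW.
move=> a f g /asboolP f0 /asboolP g0; apply/asboolP.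
apply: filterS2 f0 g0 => x fx gx.
have -> : (a *: f + g) x = a * f x + g x by [].
by rewrite fx gx mulr0 addr0.
Qed.

HB.instance Definition _ := GRing.isSubmodClosed.Build C sqfun ae_null
  ae_null_submod_closed.

Definition L2 : Type := Quotient.quot ae_null.
HB.instance Definition _ := Choice.on L2.
HB.instance Definition _ := EqQuotient.on L2.
HB.instance Definition _ := GRing.Zmodule.on L2.

Definition L2_to_fun (f : L2) : X -> C := sqfun_val (repr f).

Definition L2_scale (a : C) (f : L2) : L2 := \pi_L2 (a *: repr f).

Lemma pi_L2_eq (f g : sqfun) : (f - g \in ae_null) = (\pi_L2 f == \pi_L2 g).
Proof. exact: Quotient.idealrBE. Qed.

Lemma pi_L2D (f g : sqfun) : \pi_L2 (f + g) = \pi_L2 f + \pi_L2 g.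
Proof. exact: (raddfD \pi_(Quotient.quot ae_null)). Qed.

Lemma pi_L2_scale a (f : sqfun) : L2_scale a (\pi_L2 f) = \pi_L2 (a *: f).
Proof.
apply/eqP; rewrite -pi_L2_eq -scalerBr.
by apply: rpredZ; rewrite pi_L2_eq reprK.
Qed.

Lemma L2_scaleA a b f : L2_scale a (L2_scale b f) = L2_scale (a * b) f.
Proof. by rewrite [L2_scale b f]/L2_scale pi_L2_scale scalerA. Qed.

Lemma L2_scale1 : left_id 1 L2_scale.
Proof. by move=> f; rewrite /L2_scale scale1r reprK. Qed.

Lemma L2_scaleDr : right_distributive L2_scale +%R.
Proof.
move=> a f g.
have {1}-> : f + g = \pi_L2 (repr f + repr g) by rewrite pi_L2D !reprK.
by rewrite pi_L2_scale scalerDr pi_L2D.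
Qed.

Lemma L2_scaleDl f : {morph L2_scale^~ f : a b / a + b}.
Proof. by move=> a b; rewrite /L2_scale scalerDl pi_L2D. Qed.

HB.instance Definition _ := GRing.Zmodule_isLmodule.Build C L2
  L2_scaleA L2_scale1 L2_scaleDr L2_scaleDl.

End ComplexL2.

Section L2Hilbert.
Context {d : measure_display} {X : measurableType d} {R : realType}.
Variable mu : {measure set X -> \bar R}.
Local Notation C := R[i].

(* The class of f; the junk value 0 is only taken when f is not square
   integrable. *)
Definition toL2 (f : X -> C) : L2 mu := \pi_(L2 mu) (insubd (0 : sqfun mu) f).

Definition cintegral (f : X -> C) : C :=
  Complex (\int[mu]_x complex.Re (f x)) (\int[mu]_x complex.Im (f x)).

Definition L2_ip (f g : L2 mu) : C :=
  cintegral (fun x => L2_to_fun f x * (L2_to_fun g x)^*%C).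

End L2Hilbert.

Section Operators.
Context {R : realType}.
Local Notation C := R[i].

Definition ip_norm (H : lmodType C) (ip : H -> H -> C) (f : H) : R :=
  Num.sqrt (complex.Re (ip f f)).

Definition bounded_operator (H : lmodType C) (ip : H -> H -> C) (T : H -> H)
    : Prop :=
  linear T /\ exists M : R, forall f, ip_norm ip (T f) <= M * ip_norm ip f.

Definition is_adjoint (H : lmodType C) (ip : H -> H -> C) (T Tstar : H -> H)
    : Prop :=
  forall f g, ip (T f) g = ip f (Tstar g).

Definition unitary_operator (H H' : lmodType C) (ip : H -> H -> C)
    (ip' : H' -> H' -> C) (U : H' -> H) : Prop :=
  [/\ linear U, forall f g, ip (U f) (U g) = ip' f g & forall h, exists f, U f = h].

Definition CK_operators (L : finType) (A : L -> L -> bool) (H : lmodType C)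
    (ip : H -> H -> C) (T : L -> H -> H) : Prop :=
  exists Tstar : L -> H -> H,
    [/\ forall i, bounded_operator ip (T i) /\ bounded_operator ip (Tstar i),
        forall i, is_adjoint ip (T i) (Tstar i),
        forall i f, T i (Tstar i (T i f)) = T i f,
        forall f, \sum_i T i (Tstar i f) = f &
        forall i f, Tstar i (T i f) = \sum_j (A i j)%:R *: T j (Tstar j f)].

End Operators.

Record cstarAlgebra (R : realType) := CStarAlgebra {
  cs_space :> completeNormedModType R[i];
  cs_mul : cs_space -> cs_space -> cs_space;
  cs_one : cs_space;
  cs_star : cs_space -> cs_space;
  cs_mulA : associative cs_mul;
  cs_mul1l : left_id cs_one cs_mul;
  cs_mul1r : right_id cs_one cs_mul;
  cs_mulDl : left_distributive cs_mul +%R;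
  cs_mulDr : right_distributive cs_mul +%R;
  cs_mulZl : forall (c : R[i]) a b, cs_mul (c *: a) b = c *: cs_mul a b;
  cs_mulZr : forall (c : R[i]) a b, cs_mul a (c *: b) = c *: cs_mul a b;
  cs_starK : involutive cs_star;
  cs_starD : {morph cs_star : a b / a + b};
  cs_starZ : forall (c : R[i]) a, cs_star (c *: a) = c^*%C *: cs_star a;
  cs_starM : forall a b, cs_star (cs_mul a b) = cs_mul (cs_star b) (cs_star a);
  cs_normM : forall a b, `|cs_mul a b| <= `|a| * `|b|;
  cs_normC : forall a, `|cs_mul (cs_star a) a| = `|a| ^+ 2
}.

Section CuntzKriegerAlgebra.
Context {R : realType} {L : finType}.

Definition closed_star_subalgebra (O : cstarAlgebra R) (P : set O) : Prop :=
  closed P /\ P (cs_one O) /\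
  (forall a b, P a -> P b -> P (a + b)) /\
  (forall (c : R[i]) a, P a -> P (c *: a)) /\
  (forall a b, P a -> P b -> P (cs_mul a b)) /\
  (forall a, P a -> P (cs_star a)).

Definition CK_elements (A : L -> L -> bool) (O : cstarAlgebra R) (S : L -> O)
    : Prop :=
  [/\ forall i, cs_mul (cs_mul (S i) (cs_star (S i))) (S i) = S i,
      \sum_i cs_mul (S i) (cs_star (S i)) = cs_one O &
      forall i, cs_mul (cs_star (S i)) (S i)
              = \sum_j (A i j)%:R *: cs_mul (S j) (cs_star (S j))].

(* O is generated, as a C*-algebra, by a Cuntz-Krieger family S of A.
   Universality of (O, S) is not demanded, so that a statement about all such
   O applies in particular to the universal algebra O_A. *)
Definition is_CK_algebra (A : L -> L -> bool) (O : cstarAlgebra R) (S : L -> O)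
    : Prop :=
  CK_elements A S /\
  (forall P : set O, closed_star_subalgebra P -> (forall i, P (S i)) ->
    forall a, P a).

(* A unital *-homomorphism is automatically continuous; this is not assumed. *)
Definition is_representation (O : cstarAlgebra R) (H : lmodType R[i])
    (ip : H -> H -> R[i]) (pi : O -> H -> H) : Prop :=
  [/\ forall a, bounded_operator ip (pi a),
      forall (c : R[i]) a b f, pi (c *: a + b) f = c *: pi a f + pi b f,
      forall a b f, pi (cs_mul a b) f = pi a (pi b f),
      forall f, pi (cs_one O) f = f &
      forall a, is_adjoint ip (pi a) (pi (cs_star a))].

End CuntzKriegerAlgebra.

(* The maps are total functions; only the values of [sfs_map i] on [sfs_dom i]
   are meaningful. *)
Record sfs_data (L : finType) (X : Type) := SfsData {
  sfs_dom : L -> set X;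
  sfs_map : L -> X -> X;
  sfs_coding : X -> X
}.

Section SFS.
Context {R : realType} {L : finType}.
Context {d : measure_display} {X : measurableType d}.
Variable m : probability X R.
Implicit Type s : sfs_data L X.

Definition nonatomic : Prop :=
  forall B, measurable B -> (0 < m B)%E ->
    exists2 B', measurable B' & B' `<=` B /\ (0 < m B' < m B)%E.

Definition eq_mod0 (B B' : set X) : Prop := {ae m, forall x, B x <-> B' x}.

(* f maps B one-to-one, modulo m, into Y; moreover f maps measurable subsets
   of B to measurable sets, so that C |-> m' (f C) makes sense on B. *)
Definition one_to_one_map d' (Y : measurableType d') (B : set X) (f : X -> Y)
    : Prop :=
  [/\ measurable_fun B f,
      exists2 N, m.-negligible N & {in B `\` N &, injective f} &
      forall C, measurable C -> C `<=` B -> measurable (f @` C)].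

Definition sfs_ran s i : set X := sfs_map s i @` sfs_dom s i.

(* r is a version of the Radon-Nikodym derivative on D_i of C |-> m (sigma_i C)
   with respect to m. *)
Definition is_RN_derivative s i (r : X -> R) : Prop :=
  measurable_fun setT r /\
  (forall C, measurable C -> C `<=` sfs_dom s i ->
    m (sfs_map s i @` C) = \int[m]_(x in C) (r x)%:E)%E.

Definition is_sfs s : Prop :=
  (forall i, measurable (sfs_dom s i)) /\
  (forall i, one_to_one_map (sfs_dom s i) (sfs_map s i)) /\
  (forall i j, i != j -> m (sfs_ran s i `&` sfs_ran s j) = 0%E) /\
  m (~` \bigcup_i sfs_ran s i) = 0%E /\
  (forall i C, measurable C -> C `<=` sfs_dom s i -> m C = 0%E ->
    m (sfs_map s i @` C) = 0%E) /\
  (forall i r, is_RN_derivative s i r ->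
    {ae m, forall x, sfs_dom s i x -> 0 < r x}) /\
  measurable_fun setT (sfs_coding s) /\
  (forall i, {ae m, forall x, sfs_dom s i x ->
    sfs_coding s (sfs_map s i x) = x}).

Definition saturated s : Prop := eq_mod0 (\bigcup_i sfs_dom s i) setT.

(* [A i j] says that j is in Lambda_i. *)
Definition CK_matrix s (A : L -> L -> bool) : Prop :=
  forall i, eq_mod0 (sfs_dom s i) (\bigcup_(j in [set j | A i j]) sfs_ran s j).

Definition condition_CK s : Prop := exists A, CK_matrix s A.

(* The operator T_i on L^2(X, m), for a version rho_i of the Radon-Nikodym
   derivative of sigma_i. *)
Definition sfs_operator_fun s (rho : L -> X -> R) i (psi : X -> R[i]) (x : X)
    : R[i] :=
  (\1_(sfs_ran s i) x * rho i (sfs_coding s x) `^ (- 2^-1))%:C%C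
  * psi (sfs_coding s x).

Definition sfs_operator s (rho : L -> X -> R) i (psi : L2 m) : L2 m :=
  toL2 m (sfs_operator_fun s rho i (L2_to_fun psi)).

End SFS.

(* Isomorphism of two systems, the first of which has Cuntz-Krieger matrix A. *)
Definition isomorphic_sfs (R : realType) (L : finType)
    (d d' : measure_display) (X : measurableType d) (X' : measurableType d')
    (m : probability X R) (m' : probability X' R)
    (s : sfs_data L X) (s' : sfs_data L X') (A : L -> L -> bool) : Prop :=
  exists phi Phi : L -> X -> X',
    [/\ forall i, one_to_one_map m (sfs_ran s i) (phi i) /\
          eq_mod0 m' (phi i @` sfs_ran s i) (sfs_ran s' i),
        forall i C, measurable C -> C `<=` sfs_ran s i ->
          m' (phi i @` C) = 0%E <-> m C = 0%E,
        forall i j, A i j -> {ae m, forall x, sfs_ran s j x ->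
          Phi i x = phi j x} &
        forall i, {ae m, forall x, sfs_dom s i x ->
          sfs_dom s' i (Phi i x) /\
          phi i (sfs_map s i x) = sfs_map s' i (Phi i x)}].

(* Main.v *)
(* Each sigma_i is a nonsingular bijection from D_i to R_i modulo null sets, and
   T_i^* is the weighted composition f |-> rho_i^(1/2) (f o sigma_i) on D_i; the
   Cuntz-Krieger relations say that T_i T_i^* and T_i^* T_i are multiplication
   by the indicators of R_i and D_i.  Gluing the phi_i gives a nonsingular
   bijection Theta from X to X' that maps R_i to R'_i and conjugates sigma_i to
   sigma'_i, hence maps D_i to D'_i.  Then U f = w (f o Theta) is unitary, where
   w^2 is the density of m' o Theta.  Both T_i^* U and U T'_i^* are weighted
   compositions with Theta o sigma_i = sigma'_i o Theta and their squared weights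
   are densities of the same measure, so they agree; U intertwines the T_i by
   taking adjoints.  The set of a with U pi'(a) = pi(a) U is a *-subalgebra
   containing the generators; it is closed because a *-representation by bounded
   operators is contractive, which is obtained from the Neumann series. *)
Require Import Defs.
From HB Require Import structures.
From mathcomp Require Import all_boot all_order all_algebra.
From mathcomp Require Import complex ring lra.
From mathcomp Require Import all_classical all_reals all_analysis.
From mathcomp Require Import measurable_realfun.

Set Implicit Arguments.
Unset Strict Implicit.
Unset Printing Implicit Defensive.

Import Order.TTheory GRing.Theory Num.Theory.
Import numFieldNormedType.Exports.

Local Open Scope classical_set_scope.
Local Open Scope ring_scope.

(** * Square-integrable classes *)

(** The maps [sigma_i] and [phi_i] are partial and injective only up to null sets, so they have no
    inverse on the nose. The record [weighted_iso] therefore carries both directions as total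
    measurable maps, together with a density. It is closed under inversion and covers [sigma_i]
    (with [sigma] as inverse) as well as the glued map, so that one calculus of weighted
    compositions serves [T_i], [T_i^*] and [U]. The isomorphism says directly only that [Theta] maps
    [D_i] into [D'_i]. Equality is forced by the correspondence of [R_i] and [R'_i]: a point of
    [D'_i] is pushed into [R'_i] by [sigma'_i], pulled back to [R_i] and decoded there. Adjoints are
    compared because the conjugation hypothesis lives on [D_i] and concerns [sigma_i], hence
    [T_i^*]. A measure determines only the squares of the weights; positivity then gives the
    weights. In the passage to the algebra, the completeness that matters is that of the algebra,
    where the Neumann series converges; the Hilbert spaces enter through their inner products. *)

Section L2_classes.
Context {d : measure_display} {X : measurableType d} {R : realType}.
Variable mu : {measure set X -> \bar R}.
Local Notation C := R[i].
Implicit Types (f g h : L2 mu) (u v : X -> C).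

Lemma sq_integrable_L2 f : sq_integrable mu (L2_to_fun f).
Proof. by apply/asboolP; exact: (valP (repr f)). Qed.

Lemma pi_L2_eqP (u v : sqfun mu) :
  \pi_(L2 mu)%qT u = \pi_(L2 mu)%qT v <-> {ae mu, forall x, u x = v x}.
Proof.
rewrite (rwP eqP) -pi_L2_eq; split.
  move/asboolP; apply: filterS => x.
  by rewrite (_ : (u - v) x = u x - v x)// => /eqP; rewrite subr_eq0 => /eqP.
move=> uv; apply/asboolP; apply: filterS uv => x.
by rewrite (_ : (u - v) x = u x - v x)// => ->; rewrite subrr.
Qed.

Lemma L2_to_fun_pi (u : sqfun mu) :
  {ae mu, forall x, L2_to_fun (\pi_(L2 mu)%qT u) x = u x}.
Proof. by apply/pi_L2_eqP; rewrite reprK. Qed.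

Lemma L2P f g :
  f = g <-> {ae mu, forall x, L2_to_fun f x = L2_to_fun g x}.
Proof.
by rewrite -[f in f = _]reprK -[g in _ = g]reprK pi_L2_eqP.
Qed.

Lemma toL2E u : sq_integrable mu u ->
  {ae mu, forall x, L2_to_fun (toL2 mu u) x = u x}.
Proof.
move=> /asboolP su; rewrite /toL2.
apply: filterS (L2_to_fun_pi (insubd (0 : sqfun mu) u)) => x ->.
by have -> : sqfun_val (insubd (0 : sqfun mu) u) = u by exact: insubdK.
Qed.

Lemma L2_to_funD f g :
  {ae mu, forall x, L2_to_fun (f + g) x = L2_to_fun f x + L2_to_fun g x}.
Proof.
have -> : f + g = \pi_(L2 mu)%qT (repr f + repr g) by rewrite pi_L2D !reprK.
exact: L2_to_fun_pi.
Qed.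

Lemma L2_to_funZ a f :
  {ae mu, forall x, L2_to_fun (a *: f) x = a * L2_to_fun f x}.
Proof. exact: L2_to_fun_pi. Qed.

Lemma L2_to_fun0 : {ae mu, forall x, L2_to_fun (0 : L2 mu) x = 0}.
Proof.
have := L2_to_funZ 0 0; rewrite scale0r.
by apply: filterS => x ->; rewrite mul0r.
Qed.

Lemma L2_to_fun_sum (I : Type) (r : seq I) (F : I -> L2 mu) :
  {ae mu, forall x,
    L2_to_fun (\sum_(i <- r) F i) x = \sum_(i <- r) L2_to_fun (F i) x}.
Proof.
elim: r => [|i r IH].
  by apply: filterS L2_to_fun0 => x; rewrite !big_nil.
rewrite big_cons.
apply: filterS2 IH (L2_to_funD (F i) (\sum_(j <- r) F j)) => x IH ->.
by rewrite IH big_cons.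
Qed.

Lemma L2_linearP (H : lmodType C) (T : H -> L2 mu) :
  (forall (a : C) (f g : H), {ae mu, forall x, L2_to_fun (T (a *: f + g)) x
     = a * L2_to_fun (T f) x + L2_to_fun (T g) x}) -> linear T.
Proof.
move=> TD a f g; apply/L2P.
apply: filterS3 (TD a f g) (L2_to_funD (a *: T f) (T g)) (L2_to_funZ a (T f)).
by move=> x -> -> ->.
Qed.

End L2_classes.

(** * The inner product of L^2 in real coordinates *)

Section L2_inner_product.
Context {d : measure_display} {X : measurableType d} {R : realType}.
Variable mu : {measure set X -> \bar R}.
Local Notation C := R[i].
Implicit Types (f g h : L2 mu) (u v : X -> C).

(** With [im_mulc], the two parts of [z] times the conjugate of [w], as real polynomials to which
    real integration applies. *)
Definition re_mulc (z w : C) : R :=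
  complex.Re z * complex.Re w + complex.Im z * complex.Im w.
Definition im_mulc (z w : C) : R :=
  complex.Im z * complex.Re w - complex.Re z * complex.Im w.

Lemma mulcJE (z w : C) : z * (w^*)%C = Complex (re_mulc z w) (im_mulc z w).
Proof.
by case: z w => a b [c e]; rewrite /re_mulc /im_mulc /=; congr Complex; ring.
Qed.

Lemma L2_ipE f g : L2_ip f g =
  Complex (\int[mu]_x re_mulc (L2_to_fun f x) (L2_to_fun g x))
    (\int[mu]_x im_mulc (L2_to_fun f x) (L2_to_fun g x)).
Proof.
by rewrite /L2_ip /cintegral; congr Complex; apply: eq_Rintegral => x _;
  rewrite mulcJE.
Qed.

Lemma measurable_re_mulc u v : cmeasurable u -> cmeasurable v ->
  measurable_fun setT (fun x => re_mulc (u x) (v x)).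
Proof.
move=> [u1 u2] [v1 v2]; apply: measurable_funD; exact: measurable_funM.
Qed.

Lemma measurable_im_mulc u v : cmeasurable u -> cmeasurable v ->
  measurable_fun setT (fun x => im_mulc (u x) (v x)).
Proof.
move=> [u1 u2] [v1 v2]; apply: measurable_funB; exact: measurable_funM.
Qed.

Lemma norm_re_mulc_le (z w : C) : `|re_mulc z w| <= cnormsq z + cnormsq w.
Proof.
case: z w => a b [c e]; rewrite /re_mulc /cnormsq /= ler_norml; apply/andP.
have := (sqr_ge0 (a + c), sqr_ge0 (a - c), sqr_ge0 (b + e), sqr_ge0 (b - e)).
move=> [[[h1 h2] h3] h4]; have := (sqr_ge0 a, sqr_ge0 b, sqr_ge0 c, sqr_ge0 e).
by move=> [[[h5 h6] h7] h8]; split; nra.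
Qed.

Lemma norm_im_mulc_le (z w : C) : `|im_mulc z w| <= cnormsq z + cnormsq w.
Proof.
case: z w => a b [c e]; rewrite /im_mulc /cnormsq /= ler_norml; apply/andP.
have := (sqr_ge0 (b + c), sqr_ge0 (b - c), sqr_ge0 (a + e), sqr_ge0 (a - e)).
move=> [[[h1 h2] h3] h4]; have := (sqr_ge0 a, sqr_ge0 b, sqr_ge0 c, sqr_ge0 e).
by move=> [[[h5 h6] h7] h8]; split; nra.
Qed.

Lemma integrable_cnormsq u : sq_integrable mu u ->
  mu.-integrable setT (EFin \o (fun x => cnormsq (u x))).
Proof.
move=> [mu_ iu]; apply/integrableP; split; first exact: measurable_cnormsq.
under eq_integral do rewrite /= ger0_norm ?cnormsq_ge0//.
exact: iu.
Qed.

Lemma integrable_re_mulc u v : sq_integrable mu u -> sq_integrable mu v ->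
  mu.-integrable setT (EFin \o (fun x => re_mulc (u x) (v x))).
Proof.
move=> su sv.
apply: (le_integrable measurableT _ _
  (integrableD measurableT (integrable_cnormsq su) (integrable_cnormsq sv))).
  by apply/measurable_EFinP; apply: measurable_re_mulc; [case: su|case: sv].
move=> x _ /=; rewrite lee_fin.
exact: le_trans (norm_re_mulc_le _ _) (ler_norm _).
Qed.

Lemma integrable_im_mulc u v : sq_integrable mu u -> sq_integrable mu v ->
  mu.-integrable setT (EFin \o (fun x => im_mulc (u x) (v x))).
Proof.
move=> su sv.
apply: (le_integrable measurableT _ _
  (integrableD measurableT (integrable_cnormsq su) (integrable_cnormsq sv))).
  by apply/measurable_EFinP; apply: measurable_im_mulc; [case: su|case: sv].
move=> x _ /=; rewrite lee_fin.
exact: le_trans (norm_im_mulc_le _ _) (ler_norm _).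
Qed.

Lemma ae_eq_Rintegral (k l : X -> R) : measurable_fun setT k ->
  measurable_fun setT l -> {ae mu, forall x, k x = l x} ->
  (\int[mu]_x k x = \int[mu]_x l x)%R.
Proof.
move=> mk ml kl; congr fine; apply: ae_eq_integral => //;
  try exact/measurable_EFinP.
by apply: filterS kl => x -> .
Qed.

End L2_inner_product.

(** Definiteness is kept apart: the bounds on representations rest on positivity, and definiteness
    enters when a vector is shown to vanish. *)
Definition semi_inner_product (R : realType) (H : lmodType R[i])
    (ip : H -> H -> R[i]) : Prop :=
  [/\ forall a f g h, ip (a *: f + g) h = a * ip f h + ip g h,
      forall f g, ip g f = ((ip f g)^*)%C &
      forall f, 0 <= complex.Re (ip f f)].

Section L2_inner_product_axioms.
Context {d : measure_display} {X : measurableType d} {R : realType}.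
Variable mu : {measure set X -> \bar R}.
Local Notation C := R[i].
Implicit Types (f g h : L2 mu) (u v : X -> C).

Let msq f : cmeasurable (L2_to_fun f).
Proof. by case: (sq_integrable_L2 f). Qed.

Lemma L2_ip_selfE f :
  L2_ip f f = Complex (\int[mu]_x cnormsq (L2_to_fun f x))%R 0.
Proof.
rewrite L2_ipE; congr Complex.
under eq_Rintegral do rewrite /im_mulc mulrC subrr.
by rewrite /Rintegral integral0.
Qed.

Lemma L2_ip_semi : semi_inner_product (@L2_ip _ _ _ mu).
Proof.
split.
- move=> a f g h; rewrite !L2_ipE.
  set F := L2_to_fun f; set G := L2_to_fun g; set K := L2_to_fun h.
  have e : {ae mu, forall x, L2_to_fun (a *: f + g) x = a * F x + G x}.
    by apply: filterS2 (L2_to_funD (a *: f) g) (L2_to_funZ a f) => x -> ->.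
  have [sF sG sK] : [/\ sq_integrable mu F, sq_integrable mu G &
      sq_integrable mu K] by split; exact: sq_integrable_L2.
  have [iFr iFi] := (integrable_re_mulc sF sK, integrable_im_mulc sF sK).
  have [iGr iGi] := (integrable_re_mulc sG sK, integrable_im_mulc sG sK).
  have mZ (c : R) (k : X -> R) : mu.-integrable setT (EFin \o k) ->
      mu.-integrable setT (EFin \o (fun x => c * k x)).
    by move=> ik; exact: (integrableZl measurableT c ik).
  case: a e => a b e; simpc; congr Complex.
    rewrite -!RintegralZl// -RintegralB ?mZ// -RintegralD//; last first.
      exact: (integrableB measurableT (mZ a _ iFr) (mZ b _ iFi)).
    apply: ae_eq_Rintegral.
    + by apply: measurable_re_mulc; exact: msq.
    + apply: measurable_funD; last by apply: measurable_re_mulc; exact: msq.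
      by apply: measurable_funB; apply: measurable_funM => //;
        [apply: measurable_re_mulc|apply: measurable_im_mulc]; exact: msq.
    + apply: filterS e => x ->; case: (F x) (G x) (K x) => [? ?] [? ?] [? ?].
      by rewrite /re_mulc /im_mulc /=; ring.
  rewrite -!RintegralZl// -RintegralD ?mZ// -RintegralD//; last first.
    exact: (integrableD measurableT (mZ a _ iFi) (mZ b _ iFr)).
  apply: ae_eq_Rintegral.
  + by apply: measurable_im_mulc; exact: msq.
  + apply: measurable_funD; last by apply: measurable_im_mulc; exact: msq.
    by apply: measurable_funD; apply: measurable_funM => //;
      [apply: measurable_im_mulc|apply: measurable_re_mulc]; exact: msq.
  + apply: filterS e => x ->; case: (F x) (G x) (K x) => [? ?] [? ?] [? ?].
    by rewrite /re_mulc /im_mulc /=; ring.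
- move=> f g; rewrite !L2_ipE /=; congr Complex.
    by apply: eq_Rintegral => x _; rewrite /re_mulc; ring.
  rewrite -mulN1r -RintegralZl//; last first.
    exact: integrable_im_mulc (sq_integrable_L2 _) (sq_integrable_L2 _).
  by apply: eq_Rintegral => x _; rewrite /im_mulc; ring.
- move=> f; rewrite L2_ip_selfE /=; apply: Rintegral_ge0 => x _.
  exact: cnormsq_ge0.
Qed.

Lemma L2_ip_definite f : complex.Re (L2_ip f f) = 0 -> f = 0.
Proof.
rewrite L2_ip_selfE /= => f0; apply/L2P.
have : (\int[mu]_x (cnormsq (L2_to_fun f x))%:E = 0)%E.
  rewrite -(@fineK _ (integral _ _ _)) ?f0//.
    by congr EFin.
  apply: (integrable_fin_num measurableT).
  exact: integrable_cnormsq (sq_integrable_L2 f).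
set k := (fun x => _) => k0.
have /ae_eq_integral_abs : (\int[mu]_x `|k x| = 0)%E.
  rewrite -[RHS]k0; apply: eq_integral => x _.
  by rewrite /k gee0_abs// lee_fin cnormsq_ge0.
move=> /(_ measurableT (measurable_cnormsq (msq f))).
apply: filterS2 (L2_to_fun0 mu) => x -> /(_ I) [].
by case: (L2_to_fun f x) => a b /eqP; rewrite /cnormsq /= paddr_eq0 ?sqr_ge0//
  !sqrf_eq0 => /andP[/eqP -> /eqP ->].
Qed.

End L2_inner_product_axioms.

(** * Weighted composition operators *)

Section almost_everywhere.
Context {d : measure_display} {X : measurableType d} {R : realType}.
Variable mu : {measure set X -> \bar R}.

Lemma ae_measure_eq0 (A : set X) : measurable A ->
  mu A = 0%E <-> {ae mu, forall x, ~ A x}.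
Proof.
move=> mA; split=> [A0|[N [mN N0 AN]]].
  by exists A; split => // x /= /contrapT.
apply/eqP; rewrite -measure_le0 -N0 le_measure ?inE// => x Ax.
by apply: AN => /=; exact.
Qed.

Lemma ae_eq_measure (A B : set X) : measurable A -> measurable B ->
  {ae mu, forall x, A x <-> B x} -> mu A = mu B.
Proof.
move=> mA mB AB; rewrite -(setIT A) -(setIT B) -!integral_indic//.
apply: ae_eq_integral => //; try exact/measurable_EFinP.
apply: filterS AB => x AB _; rewrite !indicE (_ : (x \in A) = (x \in B))//.
by apply/idP/idP; rewrite !inE => /AB.
Qed.

(** The set where an a.e. property holds may fail to be measurable; the complement of a measurable
    null cover replaces it. *)
Lemma ae_measurable_subset (P : X -> Prop) : {ae mu, forall x, P x} ->
  exists A, [/\ measurable A, {ae mu, forall x, A x} & A `<=` P].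
Proof.
move=> [N [mN N0 NP]]; exists (~` N); split; first exact: measurableC.
  by exists N; split => // x /= /contrapT.
by move=> x Nx; apply: contrapT => Px; apply: Nx; exact: NP.
Qed.

End almost_everywhere.

(** * Nonsingular isomorphisms with a density: change of variables and inversion *)

Section weighted_isomorphism.
Context {d d' : measure_display} {X : measurableType d} {Y : measurableType d'}.
Context {R : realType}.
Variables (mu : {measure set X -> \bar R}) (nu : {measure set Y -> \bar R}).

(* tau maps E onto F with inverse psi, modulo null sets, and w^2 is the density
   of nu o tau with respect to mu; the image tau(E n C) is written as
   F n psi^-1(C) in wi_cov, which is always measurable. *)
Record weighted_iso (E : set X) (F : set Y) (tau : X -> Y) (psi : Y -> X)
    (w : X -> R) : Prop := WeightedIso {
  wi_dom : measurable E;
  wi_cod : measurable F;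
  wi_fun : measurable_fun setT tau;
  wi_inv : measurable_fun setT psi;
  wi_weight : measurable_fun setT w;
  wi_gt0 : {ae mu, forall x, E x -> 0 < w x};
  wi_funK : {ae mu, forall x, E x -> F (tau x) /\ psi (tau x) = x};
  wi_invK : {ae nu, forall y, F y -> E (psi y) /\ tau (psi y) = y};
  wi_cov : forall C, measurable C ->
    (nu (F `&` psi @^-1` C) = \int[mu]_(x in E `&` C) (w x ^+ 2)%:E)%E
}.

End weighted_isomorphism.

Section weighted_isomorphism_theory.
Context {d d' : measure_display} {X : measurableType d} {Y : measurableType d'}.
Context {R : realType}.
Variables (mu : {measure set X -> \bar R}) (nu : {measure set Y -> \bar R}).
Variables (E : set X) (F : set Y) (tau : X -> Y) (psi : Y -> X) (w : X -> R).
Hypothesis I : weighted_iso mu nu E F tau psi w.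

Let mE := wi_dom I.
Let mF := wi_cod I.
Let mtau := wi_fun I.
Let mpsi := wi_inv I.
Let mw := wi_weight I.

Let mpre (B : set Y) : measurable B -> measurable (tau @^-1` B).
Proof. by move=> mB; rewrite -[X in measurable X]setTI; exact: mtau. Qed.

Let mpre' (B : set X) : measurable B -> measurable (psi @^-1` B).
Proof. by move=> mB; rewrite -[X in measurable X]setTI; exact: mpsi. Qed.

Let mw2 : measurable_fun setT (fun x => (w x ^+ 2)%:E).
Proof. by apply/measurable_EFinP; exact: measurable_funX. Qed.

(** By [wi_cov], the points of [F] that [psi] sends into a null set have as measure an integral of
    [w ^+ 2] over a null set. *)
Lemma wi_ae_inv (P : X -> Prop) : {ae mu, forall x, P x} ->
  {ae nu, forall y, F y -> P (psi y)}.
Proof.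
move=> [N [mN N0 NP]]; exists (F `&` psi @^-1` N); split.
- by apply: measurableI => //; exact: mpre'.
- rewrite (wi_cov I)//.
  rewrite (eq_integral (fun x => `|(w x ^+ 2)%:E|%E)); last first.
    by move=> x _; rewrite gee0_abs// lee_fin sqr_ge0.
  apply: integral_abs_eq0; first exact: measurableI.
    exact: measurable_funTS.
  by apply/eqP; rewrite -measure_le0 -N0 le_measure// inE//; exact: measurableI.
- move=> y /not_implyP[Fy Py]; split => //=; exact: NP.
Qed.

Lemma wi_measure_preimage (B : set Y) : measurable B ->
  nu (F `&` B) = (\int[mu]_(x in E `&` tau @^-1` B) (w x ^+ 2)%:E)%E.
Proof.
move=> mB; rewrite -(wi_cov I); last exact: mpre.
apply: ae_eq_measure; try by do ?[apply: measurableI => // | apply: mpre' |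
  apply: mpre].
apply: filterS (wi_invK I) => y FyK; split => -[Fy] /=;
  by have [_ ->] := FyK Fy.
Qed.

(** Positivity of [w] makes [tau] nonsingular: over the points of [E] sent into a null set [N], the
    integral of [w ^+ 2] is at most [nu N = 0], so these points form a null set. *)
Lemma wi_ae_fun (Q : Y -> Prop) : {ae nu, forall y, Q y} ->
  {ae mu, forall x, E x -> Q (tau x)}.
Proof.
move=> [N [mN N0 NQ]].
have mEN : measurable (E `&` tau @^-1` N) by apply: measurableI => //; exact: mpre.
have : (\int[mu]_(x in E `&` tau @^-1` N) `|(w x ^+ 2)%:E| = 0)%E.
  under eq_integral do rewrite gee0_abs ?lee_fin ?sqr_ge0//.
  rewrite -wi_measure_preimage//; apply/eqP; rewrite -measure_le0 -N0.
  by rewrite le_measure// inE//; exact: measurableI.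
move/ae_eq_integral_abs => /(_ mEN (measurable_funTS mw2)).
apply: filterS2 (wi_gt0 I) => x w0 wx Ex; apply: contrapT => Qx.
have := wx (conj Ex (NQ _ Qx)) => -[] /eqP.
by rewrite sqrf_eq0 gt_eqF// w0.
Qed.

Import HBNNSimple.

(** Change of variables [y = tau x]: [wi_measure_preimage] is the case of an indicator; simple
    functions and monotone convergence give the rest. *)
Lemma wi_ge0_integral (g : Y -> \bar R) : measurable_fun setT g ->
  (forall y, 0 <= g y)%E ->
  (\int[nu]_(y in F) g y = \int[mu]_(x in E) ((w x ^+ 2)%:E * g (tau x)))%E.
Proof.
move=> mg g0; pose h := nnsfun_approx measurableT mg.
have gE y : g y = lim ((EFin \o h n) y @[n --> \oo]).
  by apply/esym/cvg_lim => //; exact: cvg_nnsfun_approx.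
have -> : (\int[nu]_(y in F) g y =
    lim (\int[nu]_(y in F) (EFin \o h n) y @[n --> \oo]))%E.
  under eq_integral do rewrite gE.
  apply: monotone_convergence => //.
  - by move=> n; apply/measurable_EFinP; apply: measurable_funTS.
  - by move=> n y _ /=; rewrite lee_fin.
  - by move=> y _ a b ab; rewrite lee_fin; exact/lefP/nd_nnsfun_approx.
have -> : (\int[mu]_(x in E) ((w x ^+ 2)%:E * g (tau x)) =
    lim (\int[mu]_(x in E) ((w x ^+ 2)%:E * (h n (tau x))%:E) @[n --> \oo]))%E.
  have fg x : ((w x ^+ 2)%:E * g (tau x) =
      lim ((w x ^+ 2)%:E * (h n (tau x))%:E @[n --> \oo]))%E.
    apply/esym/cvg_lim => //; apply: cvgeZl => //.
    exact: cvg_nnsfun_approx.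
  under eq_integral do rewrite fg.
  apply: monotone_convergence => //.
  - move=> n; apply: measurable_funTS; apply: emeasurable_funM => //.
    by apply/measurable_EFinP; apply: measurableT_comp.
  - by move=> n x _; rewrite mule_ge0// lee_fin ?sqr_ge0.
  - move=> x _ a b ab; rewrite lee_wpmul2l ?lee_fin ?sqr_ge0//.
    exact/lefP/nd_nnsfun_approx.
congr (lim (_ @ \oo)); apply/funext => n.
transitivity (\int[nu]_(y in F)
   (\sum_(r \in range (h n)) (r * \1_(h n @^-1` [set r]) y)%:E))%E.
  by apply: eq_integral => t tE; rewrite /= fimfunE -fsumEFin.
rewrite ge0_integral_fsum//; last 2 first.
- by move=> r; apply/measurable_EFinP; exact: measurable_funM.
- by move=> r y Fy; exact: nnfun_muleindic_ge0.
transitivity (\int[mu]_(x in E) (\sum_(r \in range (h n))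
    ((w x ^+ 2)%:E * (r * \1_(h n @^-1` [set r]) (tau x))%:E)))%E; last first.
  apply: eq_integral => x xE.
  rewrite -ge0_mule_fsumr => [|r]; last exact: nnfun_muleindic_ge0.
  by rewrite fsumEFin // -(fimfunE _ (tau x)).
rewrite ge0_integral_fsum//; last 2 first.
- move=> r; apply: measurable_funTS; apply: emeasurable_funM => //.
  apply/measurable_EFinP; apply: measurable_funM => //.
  by apply: measurableT_comp.
- move=> r x Ex; apply: mule_ge0; first by rewrite lee_fin sqr_ge0.
  exact: nnfun_muleindic_ge0.
apply: eq_fsbigr => r rhn.
have r0 : 0 <= r by move: rhn; rewrite inE => -[t _ <-].
have mB : measurable (h n @^-1` [set r]) by [].
transitivity (r%:E * \int[nu]_(y in F) (\1_(h n @^-1` [set r]) y)%:E)%E.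
  by rewrite -ge0_integralZl//; last exact/measurable_EFinP.
transitivity (r%:E * \int[mu]_(x in E)
    ((w x ^+ 2)%:E * (\1_(h n @^-1` [set r]) (tau x))%:E))%E; last first.
  rewrite -ge0_integralZl//.
  - by apply: eq_integral => x _; rewrite EFinM muleCA.
  - apply: measurable_funTS; apply: emeasurable_funM => //.
    by apply/measurable_EFinP; apply: measurableT_comp.
  - by move=> x _; rewrite mule_ge0 ?lee_fin ?sqr_ge0.
congr (_ * _)%E; rewrite integral_indic// setIC wi_measure_preimage//.
rewrite integral_mkcondr; apply: eq_integral => x _.
by rewrite patchE indicE; case: ifPn => xB;
  rewrite (_ : (tau x \in _) = (x \in tau @^-1` (h n @^-1` [set r])))//
   ?xB ?(negbTE xB) ?mule1 ?mule0.
Qed.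

Lemma wi_ge0_integral_indic (h : Y -> R) : measurable_fun setT h ->
  (forall y, 0 <= h y) ->
  (\int[nu]_y (\1_F y * h y)%:E =
   \int[mu]_x (\1_E x * w x ^+ 2 * h (tau x))%:E)%E.
Proof.
move=> mh h0; transitivity (\int[nu]_(y in F) (h y)%:E)%E.
  rewrite [RHS]integral_mkcond; apply: eq_integral => y _.
  by rewrite patchE indicE; case: (y \in F); rewrite ?mul1r ?mul0r.
rewrite wi_ge0_integral//; last exact/measurable_EFinP.
rewrite integral_mkcond; apply: eq_integral => x _.
by rewrite patchE indicE; case: (x \in E); rewrite ?mul1r ?mul0r.
Qed.

(** Integrability plays no part: [Rintegral] is [fine] of a difference of two nonnegative integrals,
    and each is transported separately. *)
Lemma wi_Rintegral (h : Y -> R) : measurable_fun setT h ->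
  (\int[nu]_y (\1_F y * h y) =
   \int[mu]_x (\1_E x * w x ^+ 2 * h (tau x)))%R.
Proof.
move=> mh; congr fine; rewrite [LHS]integralE [RHS]integralE.
have posE (T : Type) (c k : T -> R) : (forall t, 0 <= c t) ->
    (fun t => (c t * k t)%:E)^\+%E = (fun t => (c t * Num.max (k t) 0)%:E).
  move=> c0; apply/funext => t.
  by rewrite funeposE -EFin_max maxr_pMr// mulr0.
have negE (T : Type) (c k : T -> R) : (forall t, 0 <= c t) ->
    (fun t => (c t * k t)%:E)^\-%E = (fun t => (c t * Num.max (- k t) 0)%:E).
  move=> c0; apply/funext => t.
  by rewrite funenegE -EFinN -EFin_max maxr_pMr// mulr0 mulrN.
have Ew0 x : 0 <= \1_E x * w x ^+ 2 by rewrite mulr_ge0 ?sqr_ge0// indicE.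
rewrite !(posE _ (\1_F)) ?(negE _ (\1_F)) ?(posE _ _ _ Ew0) ?(negE _ _ _ Ew0)//;
  try by move=> y; rewrite indicE.
congr (_ - _)%E.
- apply: (@wi_ge0_integral_indic (fun y => Num.max (h y) 0)).
    exact: measurable_maxr.
  by move=> y; rewrite le_max lexx orbT.
- apply: (@wi_ge0_integral_indic (fun y => Num.max (- h y) 0)).
    by apply: measurable_maxr => //; exact: measurableT_comp.
  by move=> y; rewrite le_max lexx orbT.
Qed.

(** The density of [mu] o [psi] at [y] is the reciprocal of [w ^+ 2] at [psi y]. Reciprocals are
    written as powers so that exponents can be merged later. *)
Lemma weighted_iso_sym :
  weighted_iso nu mu F E psi tau (fun y => w (psi y) `^ (- 1)).
Proof.
have mw' : measurable_fun setT (fun y => w (psi y) `^ (- 1)).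
  by apply: (measurableT_comp (measurable_powR _)); exact: measurableT_comp.
split => //.
- apply: filterS2 (wi_ae_inv (wi_gt0 I)) (wi_invK I) => y w0 K Fy.
  by rewrite powR_gt0// w0//; case: (K Fy).
- exact: wi_invK I.
- exact: wi_funK I.
move=> B mB; rewrite integral_mkcond.
(* The factor [w ^+ 2] and its reciprocal, which cancel on [E], are inserted so that the change of
   variables can be read from right to left. *)
transitivity (\int[mu]_x (\1_E x * w x ^+ 2 *
    (\1_B (tau x) * (w (psi (tau x)) `^ (- 1)) ^+ 2))%:E)%E; last first.
  rewrite -(wi_ge0_integral_indic (h := fun y => \1_B y * (w (psi y) `^ (- 1)) ^+ 2)).
  - apply: eq_integral => y _; rewrite patchE in_setI !indicE.
    by case: (y \in F); case: (y \in B); rewrite ?(mul1r, mul0r).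
  - apply: measurable_funM; first exact: measurable_indic.
    exact: measurable_funX.
  - by move=> y; rewrite mulr_ge0 ?sqr_ge0// indicE.
rewrite -(setIT (E `&` _)) -integral_indic//; last first.
  by apply: measurableI => //; exact: mpre.
apply: ae_eq_integral => //.
- apply/measurable_EFinP/measurable_indic.
  by apply: measurableI => //; exact: mpre.
- apply/measurable_EFinP; apply: measurable_funM.
    by apply: measurable_funM; [exact: measurable_indic|exact: measurable_funX].
  apply: measurable_funM.
    by apply: measurableT_comp => //; exact: measurable_indic.
  by apply: measurable_funX; exact: (measurableT_comp mw' mtau).
- apply: filterS2 (wi_gt0 I) (wi_funK I) => x w0 K _.
  rewrite !indicE in_setI (_ : (x \in tau @^-1` B) = (tau x \in B)); last first.
    by apply/idP/idP; rewrite !inE.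
  case: (asboolP (E x)) => [Ex|nEx]; last first.
    by rewrite (_ : (x \in E) = false) ?mul0r//; apply/negbTE; rewrite notin_setE.
  have [_ ->] := K Ex; rewrite mem_set// mul1r /= mulrCA -exprMn.
  by rewrite powR_inv1 ?(ltW (w0 Ex))// divff ?gt_eqF ?w0// expr1n mulr1.
Qed.

End weighted_isomorphism_theory.

(** * Weighted compositions as operators on L^2 *)

Section weighted_composition.
Context {d d' : measure_display} {X : measurableType d} {Y : measurableType d'}.
Context {R : realType}.
Local Notation C := R[i].

Definition weighted_comp (E : set X) (k : X -> R) (tau : X -> Y) (f : Y -> C)
    (x : X) : C :=
  (\1_E x * k x)%:C%C * f (tau x).

Lemma ReZ (r : R) (z : C) : complex.Re (r%:C%C * z) = r * complex.Re z.
Proof. by case: z => a b; simpc. Qed.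

Lemma ImZ (r : R) (z : C) : complex.Im (r%:C%C * z) = r * complex.Im z.
Proof. by case: z => a b; simpc. Qed.

Lemma cmeasurable_comp (f : Y -> C) (tau : X -> Y) :
  cmeasurable f -> measurable_fun setT tau -> cmeasurable (fun x => f (tau x)).
Proof.
move=> [fr fi] mtau; split.
  exact: (measurableT_comp fr).
exact: (measurableT_comp fi).
Qed.

Lemma cmeasurable_weighted_comp E k tau f : measurable E ->
  measurable_fun setT k -> measurable_fun setT tau -> cmeasurable f ->
  cmeasurable (weighted_comp E k tau f).
Proof.
move=> mE mk mtau [fr fi]; have mEk : measurable_fun setT (fun x => \1_E x * k x).
  by apply: measurable_funM => //; exact: measurable_indic.
split.
  rewrite (_ : (fun _ => _) = (fun x => \1_E x * k x * complex.Re (f (tau x)))).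
    by apply: measurable_funM => //; exact: (measurableT_comp fr).
  by apply/funext => x; rewrite ReZ.
rewrite (_ : (fun _ => _) = (fun x => \1_E x * k x * complex.Im (f (tau x)))).
  by apply: measurable_funM => //; exact: (measurableT_comp fi).
by apply/funext => x; rewrite ImZ.
Qed.

Lemma cnormsq_weighted_comp E k tau f x :
  cnormsq (weighted_comp E k tau f x) = \1_E x * k x ^+ 2 * cnormsq (f (tau x)).
Proof.
rewrite /cnormsq /weighted_comp ReZ ImZ !exprMn mulrDr.
by rewrite (_ : \1_E x ^+ 2 = \1_E x :> R)// indicE; case: (_ \in _);
  rewrite ?expr1n ?expr0n.
Qed.

End weighted_composition.

Section weighted_operator.
Context {d d' : measure_display} {X : measurableType d} {Y : measurableType d'}.
Context {R : realType}.
Variables (mu : {measure set X -> \bar R}) (nu : {measure set Y -> \bar R}).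
Variables (E : set X) (F : set Y) (tau : X -> Y) (psi : Y -> X) (w : X -> R).
Hypothesis I : weighted_iso mu nu E F tau psi w.
Local Notation C := R[i].

Let V := weighted_comp E w tau.

Lemma sq_integrable_weighted_comp (f : Y -> C) :
  sq_integrable nu f -> sq_integrable mu (V f).
Proof.
move=> [mf intf]; have [mE mF mtau _ mw _ _ _ _] := I.
split; first exact: cmeasurable_weighted_comp.
apply: le_lt_trans intf; under eq_integral do rewrite cnormsq_weighted_comp.
have mf2 := measurable_cnormsq mf.
rewrite -(@wi_ge0_integral_indic _ _ _ _ _ _ _ _ _ _ _ _ I (fun y => cnormsq (f y))).
- apply: ge0_le_integral => //.
  + by move=> y _; rewrite lee_fin mulr_ge0 ?cnormsq_ge0// indicE.
  + apply/measurable_EFinP; apply: measurable_funM.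
      exact: measurable_indic.
    exact/measurable_EFinP.
  + move=> y _; rewrite lee_fin indicE; case: (_ \in _).
      by rewrite mul1r.
    by rewrite mul0r cnormsq_ge0.
- exact/measurable_EFinP.
- by move=> y; exact: cnormsq_ge0.
Qed.

(** Nonsingularity of [tau] makes [V] well defined on classes. *)
Lemma weighted_comp_ae (f g : Y -> C) : {ae nu, forall y, f y = g y} ->
  {ae mu, forall x, V f x = V g x}.
Proof.
move/(wi_ae_fun I); apply: filterS => x fg; rewrite /V /weighted_comp indicE.
case: (asboolP (E x)) => [Ex|nEx]; first by rewrite fg.
by rewrite (_ : (x \in E) = false) ?mul0r//; apply/negbTE; rewrite notin_setE.
Qed.

Definition weighted_op (f : L2 nu) : L2 mu := toL2 mu (V (L2_to_fun f)).

Lemma weighted_opE f :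
  {ae mu, forall x, L2_to_fun (weighted_op f) x = V (L2_to_fun f) x}.
Proof.
apply: toL2E; apply: sq_integrable_weighted_comp; exact: sq_integrable_L2.
Qed.

Lemma weighted_op_ae f g : {ae nu, forall y, L2_to_fun f y = g y} ->
  {ae mu, forall x, L2_to_fun (weighted_op f) x = V g x}.
Proof.
move=> fg; apply: filterS2 (weighted_opE f) (weighted_comp_ae fg) => x -> ->.
by [].
Qed.

Lemma weighted_op_linear : linear weighted_op.
Proof.
apply: L2_linearP => a f g.
have e : {ae nu, forall y, L2_to_fun (a *: f + g) y =
    a * L2_to_fun f y + L2_to_fun g y}.
  by apply: filterS2 (L2_to_funD (a *: f) g) (L2_to_funZ a f) => x -> ->.
apply: filterS3 (weighted_op_ae e) (weighted_opE f) (weighted_opE g).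
move=> x -> -> ->; rewrite /V /weighted_comp; ring.
Qed.

End weighted_operator.
Arguments weighted_op {d d' X Y R} mu nu E tau w f.

Section weighted_operator_adjoint.
Context {d d' : measure_display} {X : measurableType d} {Y : measurableType d'}.
Context {R : realType}.
Variables (mu : {measure set X -> \bar R}) (nu : {measure set Y -> \bar R}).
Variables (E : set X) (F : set Y) (tau : X -> Y) (psi : Y -> X) (w : X -> R).
Hypothesis I : weighted_iso mu nu E F tau psi w.
Local Notation C := R[i].

Let w' y := w (psi y) `^ (- 1).
Let I' : weighted_iso nu mu F E psi tau w' := weighted_iso_sym I.

Let V : L2 nu -> L2 mu := weighted_op mu nu E tau w.
Let W : L2 mu -> L2 nu := weighted_op nu mu F psi w'.

Lemma weighted_opK g :
  {ae mu, forall x, L2_to_fun (V (W g)) x = (\1_E x)%:C%C * L2_to_fun g x}.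
Proof.
have WE := weighted_opE I' g.
apply: filterS3 (weighted_op_ae I WE) (wi_gt0 I) (wi_funK I) => x ->.
rewrite /weighted_comp !indicE /w'.
case: (asboolP (E x)) => [Ex|nEx] w0 K; last first.
  rewrite (_ : (x \in E) = false) ?mul0r//.
  by apply/negbTE; rewrite notin_setE.
have [Ftx ->] := K Ex; rewrite !mem_set// !mul1r mulrA -rmorphM /=.
by rewrite powR_inv1 ?(ltW (w0 Ex))// divff ?gt_eqF ?w0// rmorph1 mul1r.
Qed.

(** Under [y = tau x] the weight [w'] becomes the reciprocal of [w] and the density contributes
    [w ^+ 2], which leaves the single factor [w] of [V]. *)
Lemma weighted_op_adjoint f g : L2_ip (V f) g = L2_ip f (W g).
Proof.
have [mE mF mtau mpsi mw w0 K _ _] := I.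
have [mf _] := sq_integrable_L2 f; have [mg _] := sq_integrable_L2 g.
have mfun (H : L2 mu) : cmeasurable (L2_to_fun H).
  by case: (sq_integrable_L2 H).
have mfun' (H : L2 nu) : cmeasurable (L2_to_fun H).
  by case: (sq_integrable_L2 H).
have mw' : measurable_fun setT w' by exact: wi_weight I'.
have mgpsi : cmeasurable (fun y => L2_to_fun g (psi y)).
  exact: cmeasurable_comp.
(* Real and imaginary parts are treated at once: [B] is [re_mulc] or [im_mulc]. *)
suff key (B : C -> C -> R) :
    (forall (r : R) z z', B (r%:C%C * z) z' = r * B z z') ->
    (forall (r : R) z z', B z (r%:C%C * z') = r * B z z') ->
    (forall d0 (Z : measurableType d0) (u v : Z -> C), cmeasurable u ->
       cmeasurable v -> measurable_fun setT (fun x => B (u x) (v x))) ->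
    (\int[mu]_x B (L2_to_fun (V f) x) (L2_to_fun g x) =
    \int[nu]_y B (L2_to_fun f y) (L2_to_fun (W g) y))%R.
  rewrite !L2_ipE; congr Complex; apply: key.
  - by move=> r z z'; rewrite /re_mulc ReZ ImZ; ring.
  - by move=> r z z'; rewrite /re_mulc ReZ ImZ; ring.
  - by move=> *; exact: measurable_re_mulc.
  - by move=> r z z'; rewrite /im_mulc ReZ ImZ; ring.
  - by move=> r z z'; rewrite /im_mulc ReZ ImZ; ring.
  - by move=> *; exact: measurable_im_mulc.
move=> Bl Br mB.
transitivity (\int[nu]_y (\1_F y *
    (w' y * B (L2_to_fun f y) (L2_to_fun g (psi y)))))%R; last first.
  apply: ae_eq_Rintegral.
  - apply: measurable_funM => //; apply: measurable_funM => //.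
    exact: mB.
  - exact: mB.
  - by apply: filterS (weighted_opE I' g) => y ->; rewrite Br mulrA.
rewrite (wi_Rintegral I); last by apply: measurable_funM => //; exact: mB.
apply: ae_eq_Rintegral.
- exact: mB.
- apply: measurable_funM; first by apply: measurable_funM => //; exact: measurable_funX.
  apply: measurable_funM; first exact: measurableT_comp.
  by apply: mB; [exact: cmeasurable_comp|exact: (cmeasurable_comp mgpsi mtau)].
- apply: filterS3 (weighted_opE I f) w0 K => x -> w0 K.
  rewrite Bl !indicE; case: (asboolP (E x)) => [Ex|nEx]; last first.
    by rewrite (_ : (x \in E) = false) ?mul0r//; apply/negbTE; rewrite notin_setE.
  rewrite mem_set// !mul1r /w'; have [_ ->] := K Ex.
  rewrite powR_inv1 ?(ltW (w0 Ex))// expr2 mulrA -(mulrA (w x)).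
  by rewrite divff ?mulr1// gt_eqF// w0.
Qed.

End weighted_operator_adjoint.

Section weighted_operator_isometry.
Context {d d' : measure_display} {X : measurableType d} {Y : measurableType d'}.
Context {R : realType}.
Variables (mu : {measure set X -> \bar R}) (nu : {measure set Y -> \bar R}).
Variables (E : set X) (F : set Y) (tau : X -> Y) (psi : Y -> X) (w : X -> R).
Hypothesis I : weighted_iso mu nu E F tau psi w.

Let w' y := w (psi y) `^ (- 1).
Let I' : weighted_iso nu mu F E psi tau w' := weighted_iso_sym I.

Let V : L2 nu -> L2 mu := weighted_op mu nu E tau w.
Let W : L2 mu -> L2 nu := weighted_op nu mu F psi w'.

(** Inverting twice restores [w] only a.e., as a double reciprocal of [w (psi (tau x))], so
    [weighted_opK] for the inverse does not apply verbatim and the cancellation is redone over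
    [F]. *)
Lemma weighted_op_invK f :
  {ae nu, forall y, L2_to_fun (W (V f)) y = (\1_F y)%:C%C * L2_to_fun f y}.
Proof.
apply: filterS3 (weighted_op_ae I' (weighted_opE I f))
  (wi_ae_inv I (wi_gt0 I)) (wi_invK I) => y ->.
rewrite /weighted_comp !indicE /w'.
case: (asboolP (F y)) => [Fy|nFy] w0 K; last first.
  rewrite (_ : (y \in F) = false) ?mul0r//.
  by apply/negbTE; rewrite notin_setE.
have [Ey ->] := K Fy; have wy := w0 Fy Ey.
rewrite !mem_set// !mul1r mulrA -rmorphM /= powR_inv1 ?(ltW wy)//.
by rewrite mulVf ?gt_eqF// rmorph1 mul1r.
Qed.

(** [W V] is multiplication by the indicator of [F], so the left side is the integral of [|f|^2]
    over [F]. *)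
Lemma weighted_op_norm f :
  complex.Re (L2_ip (V f) (V f)) <= complex.Re (L2_ip f f).
Proof.
rewrite (weighted_op_adjoint I) !L2_ipE /=.
have sf := sq_integrable_L2 f.
have -> : (\int[nu]_y re_mulc (L2_to_fun f y) (L2_to_fun (W (V f)) y) =
    \int[nu]_(y in F) re_mulc (L2_to_fun f y) (L2_to_fun f y))%R.
  rewrite [RHS]Rintegral_mkcond; apply: ae_eq_Rintegral.
  - apply: measurable_re_mulc; first by case: sf.
    by case: (sq_integrable_L2 (W (V f))).
  - apply/measurable_restrict => //; first exact: wi_cod I.
    by apply: measurable_funTS; apply: measurable_re_mulc; case: sf.
  - apply: filterS (weighted_op_invK f) => y ->.
    rewrite /re_mulc ReZ ImZ patchE indicE; case: (y \in F).
      by rewrite !mul1r.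
    by rewrite !mul0r !mulr0 addr0.
rewrite [leLHS]Rintegral_mkcond; apply: le_Rintegral => //.
- rewrite -restrict_EFin -integrable_mkcond; last exact: wi_cod I.
  apply: integrableS (integrable_re_mulc sf sf) => //; exact: wi_cod I.
- exact: integrable_re_mulc.
- move=> y _; rewrite patchE; case: ifP => // _.
  by rewrite /re_mulc -!expr2 addr_ge0 ?sqr_ge0.
Qed.

Lemma weighted_op_ip f g : {ae nu, forall y, F y} ->
  L2_ip (V f) (V g) = L2_ip f g.
Proof.
move=> Fae; rewrite (weighted_op_adjoint I); congr (L2_ip _ _).
apply/L2P; apply: filterS2 Fae (weighted_op_invK g) => y Fy ->.
by rewrite indicE mem_set// rmorph1 mul1r.
Qed.

End weighted_operator_isometry.

Lemma weighted_op_bounded d (X : measurableType d) (R : realType)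
    (mu : {measure set X -> \bar R}) (E F : set X) (tau psi : X -> X)
    (w : X -> R) :
  weighted_iso mu mu E F tau psi w ->
  bounded_operator (@L2_ip _ _ _ mu) (weighted_op mu mu E tau w).
Proof.
move=> I; split; first exact: (weighted_op_linear I).
exists 1 => f; rewrite mul1r /ip_norm ler_sqrt ?(weighted_op_norm I)//.
by have [_ _] := L2_ip_semi mu; apply.
Qed.

(** * Representations of C*-algebras *)

Section Neumann_series.
Context {R : realType} (O : cstarAlgebra R).
Implicit Types a b x : O.

(** The norm of [O] takes values in [R[i]]; being nonnegative it is real, so the real part loses
    nothing. *)
Definition cs_norm a : R := complex.Re `|a|.

Lemma cs_normE a : `|a| = (cs_norm a)%:C%C.
Proof.
have := normr_ge0 a; rewrite /cs_norm; case: `|a| => u v; rewrite lecE /=.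
by case/andP => /eqP -> _.
Qed.

Lemma cs_norm_ge0 a : 0 <= cs_norm a.
Proof. by rewrite -lecR -cs_normE normr_ge0. Qed.

Lemma cs_norm_leD a b : cs_norm (a + b) <= cs_norm a + cs_norm b.
Proof. by rewrite -lecR rmorphD /= -!cs_normE ler_normD. Qed.

Lemma cs_norm_leM a b : cs_norm (cs_mul a b) <= cs_norm a * cs_norm b.
Proof. by rewrite -lecR rmorphM /= -!cs_normE cs_normM. Qed.

Lemma cs_normN a : cs_norm (- a) = cs_norm a.
Proof. by rewrite /cs_norm normrN. Qed.

Lemma cs_normZ (c : R) a : cs_norm (c%:C%C *: a) = `|c| * cs_norm a.
Proof.
apply: complexI; rewrite rmorphM /= -!cs_normE normrZ.
by rewrite normc_def /= expr0n addr0 sqrtr_sqr.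
Qed.

Lemma cs_normC_sqr a : cs_norm (cs_mul (cs_star a) a) = cs_norm a ^+ 2.
Proof. by apply: complexI; rewrite rmorphXn /= -!cs_normE cs_normC. Qed.

Lemma cs_mulBr a b c : cs_mul a (b - c) = cs_mul a b - cs_mul a c.
Proof. by rewrite -scaleN1r cs_mulDr cs_mulZr scaleN1r. Qed.

Lemma cs_mulBl a b c : cs_mul (a - b) c = cs_mul a c - cs_mul b c.
Proof. by rewrite -scaleN1r cs_mulDl cs_mulZl scaleN1r. Qed.

Lemma cs_norm_eq0 a : (forall e, 0 < e -> cs_norm a <= e) -> a = 0.
Proof.
move=> ae; apply/eqP; rewrite -normr_eq0 cs_normE; apply/eqP; congr (_%:C)%C.
by apply/eqP; rewrite eq_le cs_norm_ge0 andbT; apply/ler_addgt0Pr => e e0;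
  rewrite add0r ae.
Qed.

Lemma nbhs_cs_norm a (P : set O) :
  nbhs a P <-> exists2 e : R, 0 < e & forall b, cs_norm (a - b) < e -> P b.
Proof.
rewrite -nbhs_ballE; split.
  case=> e /= e0 eP; exists (complex.Re e); first by move: e0; rewrite ltcE => /andP[].
  move=> b abe; apply: eP; rewrite -ball_normE /= cs_normE.
  case: e e0 abe => u v; rewrite !ltcE /= => /andP[/eqP <- _] ->.
  by rewrite eqxx.
case=> e e0 eP; exists (e%:C)%C; first by rewrite /= ltcR.
by move=> b; rewrite -ball_normE /= cs_normE ltcR; exact: eP.
Qed.

Definition cs_pow x n : O := iter n (fun y : O => cs_mul y x) (cs_one O).

Definition cs_geom x n : O := \sum_(0 <= k < n) cs_pow x k.

Lemma cs_norm_pow x n : cs_norm (cs_pow x n) <= cs_norm (cs_one O) * cs_norm x ^+ n.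
Proof.
elim: n => [|n IH]; first by rewrite mulr1.
apply: le_trans (cs_norm_leM _ _) _; rewrite exprSr mulrA.
by apply: ler_wpM2r IH; exact: cs_norm_ge0.
Qed.

Lemma cs_geom_mul x n : cs_mul (cs_geom x n) (cs_one O - x) = cs_one O - cs_pow x n.
Proof.
elim: n => [|n IH].
  rewrite /cs_geom big_nil (_ : cs_pow x 0 = cs_one O)// -[in LHS](subrr x).
  by rewrite cs_mulBl !subrr.
rewrite /cs_geom big_nat_recr //= cs_mulDl -/(cs_geom x n) IH.
by rewrite cs_mulBr cs_mul1r addrA subrK.
Qed.

Lemma cs_geom_tail x n p : cs_norm x < 1 ->
  cs_norm (cs_geom x n - cs_geom x (n + p)) <=
    cs_norm (cs_one O) / (1 - cs_norm x) * cs_norm x ^+ n.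
Proof.
move=> x1; set K := cs_norm (cs_one O); set r := cs_norm x.
have r1 : 0 < 1 - r by rewrite subr_gt0.
have r0 : 0 <= r by exact: cs_norm_ge0.
have K0 : 0 <= K by exact: cs_norm_ge0.
(* The bound is sharpened by [- r ^+ (n + p)] so that the induction on [p] telescopes. *)
suff : cs_norm (cs_geom x n - cs_geom x (n + p)) <=
    K / (1 - r) * (r ^+ n - r ^+ (n + p)).
  move/le_trans; apply; apply: ler_wpM2l; first by rewrite divr_ge0// ltW.
  by rewrite gerBl exprn_ge0.
elim: p => [|p IH].
  by rewrite addn0 !subrr mulr0 /cs_norm normr0.
have -> : cs_geom x (n + p.+1) = cs_geom x (n + p) + cs_pow x (n + p).
  by rewrite addnS /cs_geom big_nat_recr.
rewrite opprD addrA.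
apply: le_trans (cs_norm_leD _ _) _; rewrite cs_normN.
apply: le_trans (lerD IH (cs_norm_pow _ _)) _.
rewrite -/K -/r le_eqVlt; apply/orP; left; apply/eqP.
by rewrite addnS exprSr; field; rewrite gt_eqF.
Qed.

(** The partial sums are Cauchy by [cs_geom_tail]. A left inverse is enough to recover a vector [g]
    from its image under [1 - x]. *)
Lemma cs_left_inverse x : cs_norm x < 1 ->
  exists c, cs_mul c (cs_one O - x) = cs_one O.
Proof.
move=> x1; set K := cs_norm (cs_one O) / (1 - cs_norm x).
have r0 : 0 <= cs_norm x by exact: cs_norm_ge0.
have Kr0 e : 0 < e -> exists N, forall n, (N <= n)%N -> K * cs_norm x ^+ n < e.
  move=> e0; have := @cvg_geometric R K (cs_norm x).
  rewrite ger0_norm// => /(_ x1) /cvgrPdist_lt /(_ e e0) [N _ NP].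
  exists N => n Nn; have := NP n Nn; rewrite sub0r normrN.
  exact: le_lt_trans (ler_norm _).
have : cvg (cs_geom x @ \oo).
  apply/cauchy_cvgP/cauchy_exP => e e0.
  have e0' : 0 < complex.Re e by move: e0; rewrite ltcE => /andP[].
  have [N NP] := Kr0 _ e0'.
  exists (cs_geom x N); exists N => // n /= Nn.
  rewrite -ball_normE /= cs_normE.
  have : cs_norm (cs_geom x N - cs_geom x n) < complex.Re e.
    by rewrite -(subnKC Nn); apply: le_lt_trans (cs_geom_tail _ _ x1) (NP _ _).
  by case: e e0 {e0' NP} => u v; rewrite !ltcE /= => /andP[/eqP <- _] ->; rewrite eqxx.
move=> /cvg_ex[c cP]; exists c; apply/eqP; rewrite -subr_eq0; apply/eqP.
apply: cs_norm_eq0 => e e0.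
set M := cs_norm (cs_one O - x).
have M0 : 0 <= M by exact: cs_norm_ge0.
(* [M] may be 0, hence the division by [M + 1]. *)
have d0 : 0 < e / 2 / (M + 1) by rewrite !divr_gt0// ltr_wpDl.
have /cP [N1 _ N1P] : nbhs c [set b | cs_norm (c - b) < e / 2 / (M + 1)].
  by apply/nbhs_cs_norm; exists (e / 2 / (M + 1)).
have [N2 N2P] : exists N, forall n, (N <= n)%N -> K * cs_norm x ^+ n < e / 2.
  by apply: Kr0; rewrite divr_gt0.
set n := maxn N1 N2.
have -> : cs_mul c (cs_one O - x) - cs_one O =
    cs_mul (c - cs_geom x n) (cs_one O - x) - cs_pow x n.
  by rewrite cs_mulBl cs_geom_mul opprB addrA addrAC addrK.
apply: le_trans (cs_norm_leD _ _) _; rewrite cs_normN (splitr e) lerD//.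
  apply: le_trans (cs_norm_leM _ _) _.
  apply: (@le_trans _ _ (e / 2 / (M + 1) * M)).
    by apply: ler_wpM2r => //; apply/ltW/N1P; exact: leq_maxl.
  rewrite -mulrA ler_piMr ?divr_ge0// ?(ltW e0)//.
  by rewrite mulrC ler_pdivrMr ?mul1r ?lerDl// ltr_wpDl.
apply: le_trans (cs_norm_pow _ _) _; apply/ltW.
apply: le_lt_trans (N2P n (leq_maxr _ _)).
apply: ler_wpM2r; first by rewrite exprn_ge0.
(* [1 - cs_norm x <= 1], so [K] dominates the norm of the unit and the same index [N2] controls
   [cs_pow x n]. *)
rewrite ler_pdivlMr ?subr_gt0// ler_piMr ?cs_norm_ge0// .
by rewrite gerBl.
Qed.

End Neumann_series.

(** * Contractivity of representations by bounded operators *)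

Section representation_contractive.
Context {R : realType} (O : cstarAlgebra R) (H : lmodType R[i]).
Variables (ip : H -> H -> R[i]) (pi : O -> H -> H).
Hypotheses (ipP : semi_inner_product ip) (piP : is_representation ip pi).

Let q f : R := complex.Re (ip f f).

Let q_ge0 f : 0 <= q f. Proof. by case: ipP => _ _; apply. Qed.

Let reip f g : R := complex.Re (ip f g).

Lemma semi_ip_sqrB (t : R) f g :
  q (g - t%:C%C *: f) = q g - 2 * t * reip g f + t ^+ 2 * q f.
Proof.
case: ipP => ipl ipJ _.
have e (a : R[i]) h h' k : ip (h + a *: h') k = ip h k + a * ip h' k.
  by rewrite addrC ipl addrC.
have e' (a : R[i]) h h' k : ip k (h + a *: h') = ip k h + a^*%C * ip k h'.
  rewrite ipJ e rmorphD rmorphM /= -!(ipJ _ k).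
  by [].
rewrite /q -scaleNr e !e' (ipJ g f) /reip.
case: (ip g g) (ip f f) (ip g f) => [a b] [a' b'] [a'' b''] /=; ring.
Qed.

Lemma repZ c a f : pi (c *: a) f = c *: pi a f.
Proof.
case: piP => _ piD _ _ _.
have pi0 : pi 0 f = 0.
  have := piD 1 0 0 f; rewrite !scale1r addr0 => /eqP.
  by rewrite -subr_eq0 opprD addrA subrr sub0r oppr_eq0 => /eqP.
by rewrite -[c *: a]addr0 piD pi0 addr0.
Qed.

(* Let be be the least constant with q (pi b f) <= be * q f.  If be exceeded the
   squared norm of b, then 1 - be^-1 b^2 would be invertible, and applying the
   bounded operator pi((1 - be^-1 b^2)^-1) would give a constant below be. *)
Lemma rep_selfadjoint_bound b t f : cs_star b = b -> cs_norm b ^+ 2 < t ->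
  q (pi b f) <= t * q f.
Proof.
move=> bb bt; case: (piP) => pib piD piM pi1 piA.
have t0 : 0 < t by apply: le_lt_trans bt; exact: sqr_ge0.
pose S := [set M : R | 0 <= M /\ forall f, q (pi b f) <= M * q f].
(* A constant for [q] is the square of one for the norm; adding 1 ensures that [1 - M^-1] below is
   nonnegative. *)
have bounded a : exists2 M : R, 1 <= M & forall f, q (pi a f) <= M * q f.
  have [_ [M MP]] := pib a; exists (M ^+ 2 + 1).
    by rewrite lerDr sqr_ge0.
  move=> g; have := MP g; rewrite /ip_norm -/(q _) -/(q g) => Mg.
  have : Num.sqrt (q (pi a g)) ^+ 2 <= (M * Num.sqrt (q g)) ^+ 2.
    by rewrite ler_pXn2r ?nnegrE ?sqrtr_ge0// (le_trans _ Mg) ?sqrtr_ge0.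
  rewrite exprMn !sqr_sqrtr ?q_ge0// => /le_trans; apply.
  by rewrite ler_wpM2r ?q_ge0// lerDl.
have [M0 M0P M0S] := bounded b.
have S0 : S !=set0 by exists M0; split => //; exact: le_trans M0P.
have Slb : has_lbound S by exists 0 => M [].
set be := inf S.
have be0 : 0 <= be by apply: lb_le_inf => // M [].
(* The infimum is itself a constant: if [q g] is positive, divide by it; if it is 0, the bound [M0]
   already forces [q (pi b g) <= 0]. *)
have beP g : q (pi b g) <= be * q g.
  have := q_ge0 g; rewrite le_eqVlt => /predU1P[g0|g0].
    by have := M0S g; rewrite -g0 !mulr0.
  rewrite -ler_pdivrMr//; apply: lb_le_inf => // M [_ MP].
  by rewrite ler_pdivrMr.
have [bet|tbe] := leP be t.
  by apply: le_trans (beP f) _; rewrite ler_wpM2r ?q_ge0.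
have be_gt0 : 0 < be by exact: lt_trans tbe.
pose x := (be^-1)%:C%C *: cs_mul b b.
have x1 : cs_norm x < 1.
  rewrite cs_normZ ger0_norm ?invr_ge0// mulrC ltr_pdivrMr// mul1r.
  apply: le_lt_trans (cs_norm_leM _ _) _; rewrite -expr2.
  exact: lt_trans tbe.
have [c cP] := cs_left_inverse x1.
have [M M1 MP] := bounded c.
have M_gt0 : 0 < M by exact: lt_le_trans M1.
have piB g : pi (cs_one O - x) g = g - (be^-1)%:C%C *: pi b (pi b g).
  rewrite -(scaleN1r x) addrC piD pi1 repZ piM scaleN1r addrC //.
(* In the expansion of [q (g - be^-1 b^2 g)] the last term, [be^-2 q (b^2 g)], is at most
   [be^-1 q (b g)], which cancels half of the cross term. *)
have key g : q g <= M * (q g - be^-1 * q (pi b g)).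
  have : pi c (pi (cs_one O - x) g) = g by rewrite -piM cP pi1.
  move=> {1}<-; apply: le_trans (MP _) _; rewrite ler_pM2l// piB semi_ip_sqrB.
  have -> : reip g (pi b (pi b g)) = q (pi b g).
    by rewrite /reip /q piA bb.
  have : be^-1 ^+ 2 * q (pi b (pi b g)) <= be^-1 * q (pi b g).
    rewrite expr2 -mulrA ler_pM2l ?invr_gt0// mulrC ler_pdivrMr// mulrC.
    exact: beP.
  lra.
have : be <= be * (1 - M^-1).
  apply: ge_inf => //; split.
    by rewrite mulr_ge0// subr_ge0 invf_le1.
  move=> g; have := key g.
  rewrite -ler_pdivrMl// => kg.
  have : be * (be^-1 * q (pi b g)) <= be * (q g - M^-1 * q g).
    by rewrite ler_pM2l//; lra.
  by rewrite mulVKf ?gt_eqF// -mulrA mulrBl mul1r.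
rewrite ler_pMr//; have : 0 < M^-1 by rewrite invr_gt0.
lra.
Qed.

(** The self-adjoint case for [a^* a], of squared norm [|a|^4 < t^2], bounds [q (a^* a f)] by
    [t^2 q f]. Expanding [0 <= q (a^* a f - t f)] then gives [2 t q (a f) <= 2 t^2 q f], in place of
    Cauchy-Schwarz. *)
Lemma rep_bound a t f : cs_norm a ^+ 2 < t -> q (pi a f) <= t * q f.
Proof.
move=> at_; case: (piP) => pib piD piM pi1 piA.
have t0 : 0 < t by apply: le_lt_trans at_; exact: sqr_ge0.
have := @rep_selfadjoint_bound (cs_mul (cs_star a) a) (t ^+ 2) f.
rewrite cs_starM cs_starK cs_normC_sqr => /(_ erefl).
have /[swap]/[apply] h : (cs_norm a ^+ 2) ^+ 2 < t ^+ 2.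
  by rewrite ltr_pXn2r ?nnegrE ?sqr_ge0 ?(ltW t0).
have := q_ge0 (pi (cs_mul (cs_star a) a) f - t%:C%C *: f).
rewrite semi_ip_sqrB piM.
have -> : reip (pi (cs_star a) (pi a f)) f = q (pi a f).
  by rewrite /reip piA cs_starK.
rewrite -piM => h'.
have : 2 * t * q (pi a f) <= 2 * t * (t * q f) by lra.
by rewrite ler_pM2l// mulr_gt0.
Qed.

End representation_contractive.

(** * From generators to the whole algebra *)

Section intertwining.
Context {R : realType} {L : finType} (O : cstarAlgebra R).
Context (H H' : lmodType R[i]).
Variables (ip : H -> H -> R[i]) (ip' : H' -> H' -> R[i]).
Hypotheses (ipP : semi_inner_product ip) (ipP' : semi_inner_product ip').
Hypothesis ip_definite : forall f, complex.Re (ip f f) = 0 -> f = 0.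
Variables (pi : O -> H -> H) (pi' : O -> H' -> H').
Hypotheses (piP : is_representation ip pi) (piP' : is_representation ip' pi').
Variables (U : H' -> H).
Hypothesis unitaryU : unitary_operator ip ip' U.

Let q f : R := complex.Re (ip f f).

Let q_ge0 f : 0 <= q f. Proof. by case: ipP => _ _; apply. Qed.

Lemma semi_ip_sqrB_le f g : q (f - g) <= 2 * q f + 2 * q g.
Proof.
have := semi_ip_sqrB ipP 1 g f; have := semi_ip_sqrB ipP (-1) g f.
rewrite !rmorphN1 !scaleN1r !scale1r opprK -/(q _) -/(q f) -/(q g) -/(q (f - g)).
by have := q_ge0 (f + g); lra.
Qed.

Lemma ip_nondegenerate f : (forall g, ip f g = 0) -> f = 0.
Proof. by move=> f0; apply: ip_definite; rewrite f0. Qed.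

Lemma semi_ipBl f g h : ip (f - g) h = ip f h - ip g h.
Proof. by case: ipP => ipl _ _; rewrite addrC -scaleN1r ipl addrC mulN1r. Qed.

Lemma intertwiner_closed_star_subalgebra :
  closed_star_subalgebra [set a | forall xi, U (pi' a xi) = pi a (U xi)].
Proof.
case: (piP) (piP') (unitaryU) => _ piD piM pi1 piA [_ piD' piM' pi1' piA'].
move=> [Ul Uip Us].
have U0 : U 0 = 0.
  by have /esym/eqP := Ul 1 0 0; rewrite !scale1r addr0 -subr_eq0 addrK => /eqP.
have UZ c f : U (c *: f) = c *: U f by rewrite -[c *: f]addr0 Ul U0 addr0.
have UD f g : U (f + g) = U f + U g by rewrite -[f]scale1r Ul !scale1r.
have piDD a b f : pi (a + b) f = pi a f + pi b f.
  by rewrite -[a]scale1r piD !scale1r.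
have piDD' a b f : pi' (a + b) f = pi' a f + pi' b f.
  by rewrite -[a]scale1r piD' !scale1r.
have piZ := repZ piP; have piZ' := repZ piP'.
have piN a f : pi (- a) f = - pi a f by rewrite -(scaleN1r a) piZ scaleN1r.
have piN' a f : pi' (- a) f = - pi' a f by rewrite -(scaleN1r a) piZ' scaleN1r.
have UN f : U (- f) = - U f by rewrite -(scaleN1r f) UZ scaleN1r.
split; [|split; [|split; [|split; [|split]]]].
- move=> a acl xi; apply/eqP; rewrite -subr_eq0; apply/eqP/ip_definite.
  set D := _ - _; apply/eqP; rewrite eq_le q_ge0 andbT.
  apply/ler_addgt0Pr => e e0; rewrite add0r.
  (* Two terms, each at most [t * q (U xi)] and counted twice, give 4; the summand 1 keeps [k]
     positive. *)
  set k := 4 * q (U xi) + 1.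
  have k0 : 0 < k by rewrite ltr_wpDl// mulr_ge0.
  set t := e / k; have t0 : 0 < t by rewrite divr_gt0.
  (* The minimum with 1 makes the squared distance at most the distance, hence below [t]. *)
  have [|b [bP ab]] := acl [set b | cs_norm (a - b) < Num.min 1 t].
    apply/nbhs_cs_norm; exists (Num.min 1 t) => //.
    by rewrite lt_min ltr01.
  move: ab => /=; rewrite lt_min => /andP[ab1 abt].
  have abt2 : cs_norm (a - b) ^+ 2 < t.
    apply: le_lt_trans abt; rewrite expr2 ler_piMr ?cs_norm_ge0//.
    exact: ltW.
  (* [b] intertwines, so subtracting it from [a] leaves [D] unchanged, and contractivity applies to
     the small element [a - b]. *)
  have -> : D = U (pi' (a - b) xi) - pi (a - b) (U xi).
    rewrite /D piDD' piDD UD piN piN' UN bP opprD addrACA.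
    by rewrite subrr addr0.
  apply: le_trans (semi_ip_sqrB_le _ _) _.
  have h1 := rep_bound ipP piP (U xi) abt2.
  have := rep_bound ipP' piP' xi abt2.
  rewrite -!Uip -/(q _) -/(q (U xi)) => h2; move: h1; rewrite -/(q _) => h1.
  have : t * k = e by rewrite divfK// gt_eqF.
  rewrite /k; lra.
- by move=> xi; rewrite pi1 pi1'.
- by move=> a b aP bP xi; rewrite piDD piDD' UD aP bP.
- by move=> c a aP xi /=; rewrite piZ piZ' UZ aP.
- by move=> a b aP bP xi; rewrite piM piM' aP bP.
(* Tested against [U eta], the star moves to the other side, where it compares [U (pi' a eta)] with
   [pi a (U eta)]; surjectivity of [U] makes these tests sufficient. *)
- move=> a aP xi; apply/eqP; rewrite -subr_eq0; apply/eqP/ip_nondegenerate => g.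
  have [eta <-] := Us g; rewrite semi_ipBl Uip.
  by rewrite (piA' (cs_star a)) piA !cs_starK -aP Uip subrr.
Qed.

Lemma intertwine_CK_algebra (A : L -> L -> bool) (S : L -> O) :
  is_CK_algebra A S -> (forall i xi, U (pi' (S i) xi) = pi (S i) (U xi)) ->
  forall a xi, U (pi' a xi) = pi a (U xi).
Proof. by move=> [_ Sgen] SP; exact: Sgen intertwiner_closed_star_subalgebra SP. Qed.

End intertwining.

(** * Semibranching function systems *)

(** [f] need not be injective on [B], so the conclusion speaks of every preimage of [y] in [B]; the
    exceptional values lie in the image of a null set. *)
Lemma ae_image (d d' : measure_display) (X : measurableType d)
    (Y : measurableType d') (R : realType) (mu : {measure set X -> \bar R})
    (nu : {measure set Y -> \bar R}) (B : set X) (f : X -> Y) (P : X -> Prop) :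
  measurable B ->
  (forall C, measurable C -> C `<=` B -> measurable (f @` C)) ->
  (forall C, measurable C -> C `<=` B -> mu C = 0%E -> nu (f @` C) = 0%E) ->
  {ae mu, forall x, P x} ->
  {ae nu, forall y, forall x, B x -> f x = y -> P x}.
Proof.
move=> mB mf f0 [N [mN N0 NP]]; have mBN := measurableI _ _ mB mN.
exists (f @` (B `&` N)); split.
- exact: mf.
- apply: f0 => //; apply/eqP; rewrite -measure_le0 -N0.
  by rewrite le_measure// inE.
- move=> y /existsNP[x /not_implyP[Bx /not_implyP[fxy Px]]].
  by exists x => //; split => //; exact: NP.
Qed.

Lemma is_adjoint_sym (R : realType) (H : lmodType R[i]) (ip : H -> H -> R[i])
    (T Tstar : H -> H) :
  semi_inner_product ip -> is_adjoint ip T Tstar -> is_adjoint ip Tstar T.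
Proof. by move=> [_ ipJ _] TT f g; rewrite ipJ -TT -ipJ. Qed.

Section sfs_weighted_isomorphism.
Context {R : realType} {L : finType}.
Context {d : measure_display} {X : measurableType d}.
Variables (m : probability X R) (s : sfs_data L X) (rho : L -> X -> R).
Hypothesis sfsP : is_sfs m s.
Hypothesis rhoP : forall i, is_RN_derivative m s i (rho i).
Local Notation C := R[i].

Lemma sfs_measurable_dom i : measurable (sfs_dom s i).
Proof. by case: sfsP. Qed.

Lemma sfs_measurable_image i B : measurable B -> B `<=` sfs_dom s i ->
  measurable (sfs_map s i @` B).
Proof. by case: sfsP => _ [inj _]; case: (inj i) => _ _; apply. Qed.

Lemma sfs_measurable_ran i : measurable (sfs_ran s i).
Proof. by apply: sfs_measurable_image => //; exact: sfs_measurable_dom. Qed.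

Lemma sfs_null_image i B : measurable B -> B `<=` sfs_dom s i -> m B = 0%E ->
  m (sfs_map s i @` B) = 0%E.
Proof. by case: sfsP => _ [_ [_ [_ [+ _]]]]; apply. Qed.

Lemma sfs_codingK i : {ae m, forall x, sfs_dom s i x ->
  sfs_coding s (sfs_map s i x) = x}.
Proof. by case: sfsP => _ [_ [_ [_ [_ [_ [_ +]]]]]]; apply. Qed.

Lemma sfs_measurable_coding : measurable_fun setT (sfs_coding s).
Proof. by case: sfsP => _ [_ [_ [_ [_ [_ [+ _]]]]]]. Qed.

Lemma sfs_RN_gt0 i : {ae m, forall x, sfs_dom s i x -> 0 < rho i x}.
Proof. by case: sfsP => _ [_ [_ [_ [_ [+ _]]]]]; apply. Qed.

(** The equivalence settles all memberships of [x] at once; finiteness of [L] gathers the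
    disjointness conditions into one null set. *)
Lemma sfs_partition :
  {ae m, forall x, exists j, forall k, sfs_ran s k x <-> k = j}.
Proof.
case: sfsP => _ [_ [disj [cover _]]].
have mR := sfs_measurable_ran.
have h1 : {ae m, forall x, exists j, sfs_ran s j x}.
  exists (~` \bigcup_i sfs_ran s i); split => //.
    apply: measurableC; apply: fin_bigcup_measurable => [|i _].
      exact: finite_finset.
    exact: mR.
  by move=> x xP [j _ jx]; apply: xP; exists j.
have h2 : {ae m, forall x, forall jk : L * L, jk.1 != jk.2 ->
    ~ (sfs_ran s jk.1 x /\ sfs_ran s jk.2 x)}.
  apply: filter_forall => -[j k] /=.
  have [->|jk] := eqVneq j k; first exact: aeW.
  have /(ae_measure_eq0 m) : measurable (sfs_ran s j `&` sfs_ran s k).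
    exact: measurableI.
  by case=> /(_ (disj _ _ jk)) h _; apply: filterS h.
apply: filterS2 h1 h2 => x [j jx] x2; exists j => k; split => [kx|->//].
by apply/eqP/negPn/negP => kj; exact: (x2 (k, j) kj).
Qed.

Lemma sfs_ae_image i (P : X -> Prop) : {ae m, forall x, P x} ->
  {ae m, forall y, forall x, sfs_dom s i x -> sfs_map s i x = y -> P x}.
Proof.
apply: ae_image; first exact: sfs_measurable_dom.
  by move=> *; exact: sfs_measurable_image.
by move=> *; exact: sfs_null_image.
Qed.

(** The coding map serves as inverse. [sigma_i] is meaningful on [D_i] only, so it is given the
    value [point] elsewhere to be measurable on the whole space. *)
Lemma sfs_weighted_iso i :
  weighted_iso m m (sfs_dom s i) (sfs_ran s i) (sfs_map s i \_ (sfs_dom s i))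
    (sfs_coding s) (fun x => rho i x `^ 2^-1).
Proof.
have mD := sfs_measurable_dom i.
have [mrho rhoE] := rhoP i.
split.
- exact: mD.
- exact: sfs_measurable_ran.
- apply/(measurable_restrictT _ mD).
  by case: sfsP => _ [inj _]; case: (inj i).
- exact: sfs_measurable_coding.
- exact: (measurableT_comp (measurable_powR _)).
- by apply: filterS (sfs_RN_gt0 i) => x r0 Dx; rewrite powR_gt0// r0.
- apply: filterS (sfs_codingK i) => x K Dx; rewrite patchE mem_set//.
  by split; [exists x|exact: K].
- apply: filterS (sfs_ae_image i (sfs_codingK i)) => y K [x Dx xy].
  by rewrite -xy (K x Dx xy Dx) patchE mem_set.
move=> B mB; have mDB := measurableI _ _ mD mB.
(* The Radon-Nikodym hypothesis speaks of direct images. They differ from preimages under [sigma]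
   within [R_i] by the image of the null set where [sigma] fails to undo [sigma_i]. *)
transitivity (m (sfs_map s i @` (sfs_dom s i `&` B))).
  apply: ae_eq_measure.
  - apply: measurableI; first exact: sfs_measurable_ran.
    by rewrite -[X in measurable X]setTI; exact: sfs_measurable_coding.
  - by apply: sfs_measurable_image.
  - apply: filterS (sfs_ae_image i (sfs_codingK i)) => y K; split.
      move=> [[x Dx xy]] /=; rewrite -xy (K x Dx xy Dx) => Bx.
      by exists x.
    move=> [x [Dx Bx] xy]; split; first by exists x.
    by rewrite /= -xy (K x Dx xy Dx).
rewrite rhoE//; apply: ae_eq_integral => //.
- by apply: measurable_funTS; exact/measurable_EFinP.
- apply: measurable_funTS; apply/measurable_EFinP; apply: measurable_funX.
  exact: (measurableT_comp (measurable_powR _)).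
- apply: filterS (sfs_RN_gt0 i) => x r0 [Dx Bx]; congr EFin.
  by rewrite powR12_sqrt ?sqr_sqrtr ?(ltW (r0 Dx)).
Qed.

(** [T_i] belongs to the inverse isomorphism, from [R_i] back to [D_i]: the exponent [-1/2] is [1/2]
    times [-1]. *)
Lemma sfs_operatorE i : sfs_operator (m:=m) s rho i =
  weighted_op m m (sfs_ran s i) (sfs_coding s)
    (fun y => (rho i (sfs_coding s y) `^ 2^-1) `^ (- 1)).
Proof.
apply/funext => f; congr toL2; apply/funext => x.
by rewrite /weighted_comp -powRrM mulrN1.
Qed.

Definition sfs_costar i : L2 m -> L2 m :=
  weighted_op m m (sfs_dom s i) (sfs_map s i \_ (sfs_dom s i))
    (fun x => rho i x `^ 2^-1).

Lemma sfs_operator_ae i (f : L2 m) : {ae m, forall x,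
  L2_to_fun (sfs_operator s rho i f) x =
  sfs_operator_fun s rho i (L2_to_fun f) x}.
Proof.
rewrite sfs_operatorE.
apply: filterS (weighted_opE (weighted_iso_sym (sfs_weighted_iso i)) f) => x ->.
by rewrite /weighted_comp /sfs_operator_fun -powRrM mulrN1.
Qed.

Lemma sfs_operatorK i (f : L2 m) : {ae m, forall x,
  L2_to_fun (sfs_operator s rho i (sfs_costar i f)) x =
  (\1_(sfs_ran s i) x)%:C%C * L2_to_fun f x}.
Proof. by rewrite sfs_operatorE; exact: weighted_op_invK (sfs_weighted_iso i) f. Qed.

Lemma sfs_costarK i (f : L2 m) : {ae m, forall x,
  L2_to_fun (sfs_costar i (sfs_operator s rho i f)) x =
  (\1_(sfs_dom s i) x)%:C%C * L2_to_fun f x}.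
Proof. by rewrite sfs_operatorE; exact: weighted_opK (sfs_weighted_iso i) f. Qed.

Lemma sfs_operator_adjoint i :
  is_adjoint (@L2_ip _ _ _ m) (sfs_operator s rho i) (sfs_costar i).
Proof.
rewrite sfs_operatorE; apply: (is_adjoint_sym (L2_ip_semi m)) => f g.
exact: weighted_op_adjoint (sfs_weighted_iso i) f g.
Qed.

Lemma sfs_operator_bounded i :
  bounded_operator (@L2_ip _ _ _ m) (sfs_operator s rho i).
Proof.
rewrite sfs_operatorE.
exact: weighted_op_bounded (weighted_iso_sym (sfs_weighted_iso i)).
Qed.

Lemma sfs_ran_sum (a : L -> C) (z : C) x j :
  (forall k, sfs_ran s k x <-> k = j) ->
  \sum_k a k * ((\1_(sfs_ran s k) x)%:C%C * z) = a j * z.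
Proof.
move=> jP; rewrite (bigD1 j) //= big1 ?addr0 => [|k kj].
  by rewrite indicE mem_set ?rmorph1 ?mul1r//; exact/jP.
rewrite indicE (_ : (x \in _) = false) ?mul0r ?mulr0//.
by apply/negbTE; rewrite notin_setE => /jP kj'; rewrite kj' eqxx in kj.
Qed.

Lemma sfs_ran_sum1 (z : C) x j : (forall k, sfs_ran s k x <-> k = j) ->
  \sum_k (\1_(sfs_ran s k) x)%:C%C * z = z.
Proof.
move=> jP; rewrite -[RHS]mul1r -(sfs_ran_sum (fun=> 1) z jP).
by apply: eq_bigr => k _; rewrite mul1r.
Qed.

Lemma sfs_CK_operators (A : L -> L -> bool) : CK_matrix m s A ->
  CK_operators A (@L2_ip _ _ _ m) (sfs_operator s rho).
Proof.
move=> AP; exists sfs_costar; split.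
- move=> i; split; first exact: sfs_operator_bounded.
  exact: weighted_op_bounded (sfs_weighted_iso i).
- exact: sfs_operator_adjoint.
- move=> i f; apply/L2P.
  apply: filterS2 (sfs_operatorK i (sfs_operator s rho i f)) (sfs_operator_ae i f).
  move=> x -> ->; rewrite /sfs_operator_fun mulrA -rmorphM /= mulrA.
  by congr ((_ * _)%:C%C * _); rewrite indicE; case: (_ \in _); rewrite ?mul1r ?mul0r.
- move=> f; apply/L2P.
  have K : {ae m, forall x, forall i,
      L2_to_fun (sfs_operator s rho i (sfs_costar i f)) x =
      (\1_(sfs_ran s i) x)%:C%C * L2_to_fun f x}.
    by apply: filter_forall => i; exact: sfs_operatorK.
  have sumE := L2_to_fun_sum (index_enum L)
    (fun i => sfs_operator s rho i (sfs_costar i f)).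
  apply: filterS3 sumE K sfs_partition => x -> K [j jP].
  by under eq_bigr do rewrite K; exact: sfs_ran_sum1 jP.
- move=> i f; apply/L2P.
  have K : {ae m, forall x, forall j,
      L2_to_fun ((A i j)%:R *: sfs_operator s rho j (sfs_costar j f)) x =
      (A i j)%:R * ((\1_(sfs_ran s j) x)%:C%C * L2_to_fun f x)}.
    apply: filter_forall => j; have := L2_to_funZ (A i j)%:R
      (sfs_operator s rho j (sfs_costar j f)).
    by apply: filterS2 (sfs_operatorK j f) => x -> ->.
  have E : {ae m, forall x,
      L2_to_fun (\sum_j (A i j)%:R *: sfs_operator s rho j (sfs_costar j f)) x =
      \sum_j (A i j)%:R * ((\1_(sfs_ran s j) x)%:C%C * L2_to_fun f x)}.
    have sumE := L2_to_fun_sum (index_enum L)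
      (fun j => (A i j)%:R *: sfs_operator s rho j (sfs_costar j f)).
    by apply: filterS2 sumE K => x -> K; apply: eq_bigr => j _; exact: K.
  (* At a point of [R_j], membership in [D_i] is the entry [A i j]: this is condition (C-K). *)
  have DA : {ae m, forall x, exists j,
      (forall k, sfs_ran s k x <-> k = j) /\ (x \in sfs_dom s i) = A i j}.
    have Ai : {ae m, forall x, sfs_dom s i x <->
        (\bigcup_(j in [set j | A i j]) sfs_ran s j) x} := AP i.
    apply: filterS2 Ai sfs_partition => x Dx [j jP]; exists j.
    split=> //; apply/idP/idP; rewrite inE.
      by move=> /Dx [k /= Aik /jP kj]; rewrite -kj.
    by move=> Aij; apply/Dx; exists j => //; exact/jP.
  apply: filterS3 DA E (sfs_costarK i f) => x [j [jP Dj]] -> ->; apply/esym.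
  rewrite (sfs_ran_sum (fun j => (A i j)%:R) _ jP) indicE Dj.
  by congr (_ * _); case: (A i j).
Qed.

End sfs_weighted_isomorphism.

(** * Restriction, composition and uniqueness of densities *)

Section restriction_composition.
Context {d1 d2 d3 : measure_display} {X : measurableType d1}.
Context {Y : measurableType d2} {Z : measurableType d3} {R : realType}.
Variables (mu : {measure set X -> \bar R}) (nu : {measure set Y -> \bar R}).
Variable ka : {measure set Z -> \bar R}.

Lemma weighted_iso_restrict E F tau psi w (E1 : set X) (F1 : set Y) :
  weighted_iso mu nu E F tau psi w -> measurable E1 -> measurable F1 ->
  {ae mu, forall x, E x -> (E1 x <-> F1 (tau x))} ->
  weighted_iso mu nu (E `&` E1) (F `&` F1) tau psi w.
Proof.
move=> I mE1 mF1 EF; have [mE mF mtau mpsi mw w0 K K' cov] := I.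
have FE : {ae nu, forall y, F y -> (F1 y <-> E1 (psi y))}.
  apply: filterS2 (wi_ae_inv I EF) K' => y + KF Fy.
  by have [Ey ty] := KF Fy => /(_ Fy Ey); rewrite ty => -[? ?]; split.
split => //; try exact: measurableI.
- by apply: filterS w0 => x + [Ex _]; exact.
- apply: filterS2 K EF => x Kx EFx [Ex E1x]; have [Fx tx] := Kx Ex.
  by split => //; split => //; exact/EFx.
- apply: filterS2 K' FE => y Ky FEy [Fy F1y]; have [Ey ty] := Ky Fy.
  by split => //; split => //; exact/FEy.
- move=> C mC; have mE1C := measurableI _ _ mE1 mC.
  rewrite -(setIA E) -cov//.
  have mpre B : measurable B -> measurable (psi @^-1` B).
    by move=> mB; rewrite -[X in measurable X]setTI; exact: mpsi.
  apply: ae_eq_measure.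
  + by apply: measurableI; [exact: measurableI|exact: mpre].
  + by apply: measurableI => //; exact: mpre.
  + apply: filterS FE => y FEy; split.
      by move=> [[Fy F1y] Cy]; split => //; split => //; exact/FEy.
    by move=> [Fy [E1y Cy]]; split => //; split => //; exact/FEy.
Qed.

(** The chain rule for densities. [E'] is the domain of the composite, prescribed up to a null set
    so that [D_i] itself can be used. *)
Lemma weighted_iso_comp_cov E F tau psi w F' G tau' psi' w' (E' : set X) :
  weighted_iso mu nu E F tau psi w ->
  weighted_iso nu ka F' G tau' psi' w' ->
  {ae nu, forall y, F' y -> F y} -> measurable E' ->
  {ae mu, forall x, E' x <-> E x /\ F' (tau x)} ->
  forall C, measurable C ->
  ka (G `&` (psi \o psi') @^-1` C) =
    (\int[mu]_(x in E' `&` C) ((w x * w' (tau x)) ^+ 2)%:E)%E.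
Proof.
move=> I I' F'F mE' E'P C mC.
have [mE mF mtau mpsi mw _ K _ _] := I.
have [mF' mG mtau' mpsi' mw' _ _ _ cov'] := I'.
have mpre : measurable (psi @^-1` C).
  by rewrite -[X in measurable X]setTI; exact: mpsi.
have mF'C := measurableI _ _ mF' mpre.
have mF't : measurable (tau @^-1` (F' `&` psi @^-1` C)).
  by rewrite -[X in measurable X]setTI; exact: mtau.
rewrite comp_preimage cov'//.
(* [F'] lies in [F] a.e., so the indicator of [F] required by the substitution along [tau] can be
   added. *)
transitivity (\int[nu]_y (\1_F y *
    (\1_(F' `&` psi @^-1` C) y * w' y ^+ 2))%:E)%E.
  rewrite integral_mkcond; apply: ae_eq_integral => //.
  - apply/(measurable_restrictT _ mF'C); apply: measurable_funTS.
    by apply/measurable_EFinP; exact: measurable_funX.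
  - apply/measurable_EFinP; do ![apply: measurable_funM => //];
      exact: measurable_indic.
  - apply: filterS F'F => y F'Fy _; rewrite patchE !indicE in_setI.
    case: (asboolP (F' y)) => [F'y|nF'y].
      rewrite (mem_set (F'Fy F'y)) mem_set// mul1r /=.
      by case: (_ \in _); rewrite ?mul1r ?mul0r.
    rewrite (_ : (y \in F') = false) ?mul0r ?mulr0//.
    by apply/negbTE; rewrite notin_setE.
rewrite (wi_ge0_integral_indic I); last 2 first.
- apply: measurable_funM; first exact: measurable_indic.
  exact: measurable_funX.
- by move=> y; rewrite mulr_ge0 ?sqr_ge0// indicE.
rewrite [RHS]integral_mkcond; apply: ae_eq_integral => //.
- apply/measurable_EFinP; apply: measurable_funM.
    apply: measurable_funM; first exact: measurable_indic.
    exact: measurable_funX.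
  apply: measurable_funM.
    by apply: measurableT_comp => //; exact: measurable_indic.
  by apply: measurable_funX; exact: measurableT_comp.
- apply/(measurable_restrictT _ (measurableI _ _ mE' mC)).
  apply: measurable_funTS.
  apply/measurable_EFinP; apply: measurable_funX; apply: measurable_funM => //.
  exact: measurableT_comp.
- apply: filterS2 K E'P => x Kx E'Px _; rewrite patchE !indicE !in_setI.
  case: (asboolP (E x)) => [Ex|nEx]; last first.
    rewrite (_ : (x \in E) = false) ?mul0r; last first.
      by apply/negbTE; rewrite notin_setE.
    rewrite (_ : (x \in E') = false)//.
    by apply/negbTE; rewrite notin_setE => /E'Px[].
  rewrite mem_set// mul1r; have [_ tx] := Kx Ex.
  have -> : (tau x \in psi @^-1` C) = (x \in C).
    by apply/idP/idP; rewrite !inE /= tx.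
  have -> : (x \in E') = (tau x \in F').
    by apply/idP/idP; rewrite !inE E'Px => // -[].
  case: (_ \in F'); case: (_ \in C); rewrite /= ?mul1r ?mul0r ?mulr0//.
  by rewrite exprMn.
Qed.

(** Both squares are densities of one measure, because [theta] and [theta'] agree a.e. on [G]; its
    finiteness makes them integrable. *)
Lemma weighted_iso_weight_unique (G : set Z) (theta theta' : Z -> X)
    (E : set X) (v v' : X -> R) :
  measurable E -> measurable_fun setT v -> measurable_fun setT v' ->
  (ka G < +oo)%E -> measurable G ->
  measurable_fun setT theta -> measurable_fun setT theta' ->
  {ae ka, forall z, G z -> theta z = theta' z} ->
  (forall C, measurable C ->
    ka (G `&` theta @^-1` C) = \int[mu]_(x in E `&` C) (v x ^+ 2)%:E)%E ->
  (forall C, measurable C ->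
    ka (G `&` theta' @^-1` C) = \int[mu]_(x in E `&` C) (v' x ^+ 2)%:E)%E ->
  {ae mu, forall x, E x -> v x ^+ 2 = v' x ^+ 2}.
Proof.
move=> mE mv mv' Goo mG mt mt' tt' cv cv'.
have mpre th B : measurable_fun setT th -> measurable B ->
    measurable ((th : Z -> X) @^-1` B).
  by move=> mth mB; rewrite -[X in measurable X]setTI; exact: mth.
have : ae_eq mu E (EFin \o (fun x => v x ^+ 2)) (EFin \o (fun x => v' x ^+ 2)).
  apply: integral_ae_eq => //.
  - apply/integrableP; split.
      by apply: measurable_funTS; apply/measurable_EFinP; exact: measurable_funX.
    under eq_integral do rewrite /= ger0_norm ?sqr_ge0//.
    rewrite -[X in (\int[_]_(x in X) _)%E]setIT -cv//.
    by rewrite preimage_setT setIT.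
  - by apply: measurable_funTS; apply/measurable_EFinP; exact: measurable_funX.
  - move=> C CE mC; rewrite -(setIidr CE) -cv// -cv'//.
    apply: ae_eq_measure; try by apply: measurableI => //; exact: mpre.
    apply: filterS tt' => z ttz; split => -[Gz] /=;
      by [rewrite ttz|rewrite -ttz].
by apply: filterS => x vx Ex; have [] := vx Ex.
Qed.

End restriction_composition.

(** * The density of a nonsingular bijection *)

Section nonsingular_bijection.
Context {d d' : measure_display} {X : measurableType d} {Y : measurableType d'}.
Context {R : realType}.
Variables (mu : probability X R) (nu : probability Y R).
Variables (E : set X) (f : X -> Y).
Hypothesis mE : measurable E.
Hypothesis mf : measurable_fun E f.
Hypothesis injf : {in E &, injective f}.
Hypothesis mimg : forall C, measurable C -> C `<=` E -> measurable (f @` C).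
Hypothesis null_img : forall C, measurable C -> C `<=` E ->
  nu (f @` C) = 0%E <-> mu C = 0%E.
Hypothesis Eae : {ae mu, forall x, E x}.
Hypothesis Fae : {ae nu, forall y, (f @` E) y}.

Let psi y : X := xget point [set x | E x /\ f x = y].

Let psiK x : E x -> psi (f x) = x.
Proof.
move=> Ex; rewrite /psi; case: xgetP => [z -> [Ez fzx]|/(_ x)/=[]//].
by apply: injf; rewrite ?inE.
Qed.

Let psi_preimage B : (f @` E) `&` psi @^-1` B = f @` (E `&` B).
Proof.
apply/seteqP; split.
  by move=> _ [[x Ex <-]] /=; rewrite psiK// => Bx; exists x.
by move=> _ [x [Ex Bx] <-]; split; [exists x|rewrite /= psiK].
Qed.

(** Preimages under [psi] are direct images under [f], up to the value [point] that [psi] takes off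
    the range of [f]. *)
Let mpsi : measurable_fun setT psi.
Proof.
move=> _ B mB; rewrite setTI.
have -> : psi @^-1` B = (f @` (E `&` B)) `|`
    (if point \in B then ~` (f @` E) else set0).
  rewrite -psi_preimage; apply/seteqP; split => y /=.
    move=> By; have [Fy|nFy] := pselect ((f @` E) y); first by left.
    right; move: By; rewrite /psi; case: xgetP => [x _ [Ex fxy] _|_].
      by exfalso; apply: nFy; exists x.
    by move=> Bp; rewrite mem_set.
  move=> [[]//|]; case: ifP => //; rewrite inE => Bp nFy.
  by rewrite /psi; case: xgetP => // x _ [Ex fxy]; exfalso; apply: nFy; exists x.
apply: measurableU; first by apply: mimg; [exact: measurableI|].
by case: ifP => // _; apply: measurableC; exact: mimg.
Qed.

(** Taking images under [f] and then [nu] is, up to null sets, the law of [psi] under [nu], hence a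
    probability measure with no additivity left to prove; its Radon-Nikodym derivative is
    [w ^+ 2]. *)
Lemma nonsingular_weighted_iso : exists psi w,
  weighted_iso mu nu E (f @` E) (f \_ E) psi w.
Proof.
have mF : measurable (f @` E) by exact: mimg.
pose psi' : {mfun Y >-> X} := HB.pack psi (isMeasurableFun.Build _ _ _ _ psi mpsi).
pose nu' : probability X R := distribution nu psi'.
have mpre B : measurable B -> measurable (psi @^-1` B).
  by move=> mB; rewrite -[X in measurable X]setTI; exact: mpsi.
have nu'E B : measurable B -> nu' B = nu (f @` (E `&` B)).
  move=> mB; rewrite -psi_preimage.
  transitivity (nu (psi @^-1` B)) => //; apply: ae_eq_measure.
  - exact: mpre.
  - by apply: measurableI => //; exact: mpre.
  - by apply: filterS Fae => y Fy; split => // -[].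
have dom : nu' `<< mu.
  apply/null_content_dominatesP => B mB B0; have mEB := measurableI _ _ mE mB.
  rewrite nu'E//; apply/null_img => //.
  by apply/eqP; rewrite -measure_le0 -B0 le_measure// inE.
pose g := Radon_Nikodym_SigmaFinite.f nu' mu.
have g0 x : (0 <= g x)%E by exact: Radon_Nikodym_SigmaFinite.f_ge0.
have gfin x : g x \is a fin_num by exact: Radon_Nikodym_SigmaFinite.f_fin_num.
have mg : measurable_fun setT g.
  exact: measurable_int (Radon_Nikodym_SigmaFinite.f_integrable dom).
have gint B : measurable B -> nu' B = (\int[mu]_(x in B) g x)%E.
  exact: Radon_Nikodym_SigmaFinite.f_integral.
pose w x := fine (g x) `^ 2^-1.
have w2 x : (w x ^+ 2)%:E = g x.
  by rewrite /w powR12_sqrt ?fine_ge0// sqr_sqrtr ?fine_ge0// fineK.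
exists psi, w; split => //.
- exact/(measurable_restrictT _ mE).
- apply: (measurableT_comp (measurable_powR _)).
  exact: (measurableT_comp (fine_measurable measurableT)).
(* The zero set of the derivative in [E] has an image of measure 0, and [f] reflects null sets. *)
- pose Z := E `&` g @^-1` [set 0%E].
  have mZ : measurable Z.
    by apply: measurableI => //; rewrite -[X in measurable X]setTI; exact: mg.
  have : mu Z = 0%E.
    apply/(null_img mZ); first by move=> x [].
    rewrite (_ : Z = E `&` Z); last by rewrite /Z setIA setIid.
    rewrite -nu'E// gint//; rewrite (eq_integral (cst 0%E)) ?integral0//.
    by move=> x; rewrite inE => -[].
  move/(ae_measure_eq0 mu mZ); apply: filterS => x Zx Ex.
  rewrite powR_gt0// lt_neqAle fine_ge0// andbT eq_sym; apply/eqP => gx0.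
  by apply: Zx; split => //=; rewrite -(fineK (gfin x)) gx0.
- by apply: aeW => x Ex; rewrite patchE mem_set//; split; [exists x|exact: psiK].
- by apply: aeW => _ [x Ex <-]; rewrite psiK// patchE mem_set.
- move=> C mC; rewrite psi_preimage; transitivity (nu' C); first by rewrite nu'E.
  rewrite gint//.
  under [RHS]eq_integral do rewrite w2.
  rewrite [LHS]integral_mkcond [RHS]integral_mkcond; apply: ae_eq_integral => //.
  - apply/(measurable_restrictT _ mC); exact: measurable_funTS.
  - apply/(measurable_restrictT _ (measurableI _ _ mE mC)); exact: measurable_funTS.
  - by apply: filterS Eae => x Ex _; rewrite !patchE in_setI (mem_set Ex).
Qed.

End nonsingular_bijection.

(** * Isomorphic systems *)

Section gluing.
Context {R : realType} {L : finType}.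
Context {d d' : measure_display} {X : measurableType d} {X' : measurableType d'}.
Variables (m : probability X R) (m' : probability X' R).
Variables (s : sfs_data L X) (s' : sfs_data L X').
Hypotheses (sP : is_sfs m s) (sP' : is_sfs m' s').
Variable phi : L -> X -> X'.
Hypothesis phiP : forall i, one_to_one_map m (sfs_ran s i) (phi i) /\
  eq_mod0 m' (phi i @` sfs_ran s i) (sfs_ran s' i).
Hypothesis phi0 : forall i C, measurable C -> C `<=` sfs_ran s i ->
  m' (phi i @` C) = 0%E <-> m C = 0%E.

Let mR i : measurable (sfs_ran s i) := sfs_measurable_ran sP i.

Let mphi_image i B : measurable B -> B `<=` sfs_ran s i ->
  measurable (phi i @` B).
Proof. by case: (phiP i) => -[_ _ + _]; apply. Qed.

Let phi_ae_image i (P : X -> Prop) : {ae m, forall x, P x} ->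
  {ae m', forall y, forall x, sfs_ran s i x -> phi i x = y -> P x}.
Proof.
apply: ae_image => //; first exact: mphi_image.
by move=> B mB BR B0; apply/phi0.
Qed.

Let phi_ae_preimage i (Q : X' -> Prop) : {ae m', forall y, Q y} ->
  {ae m, forall x, sfs_ran s i x -> Q (phi i x)}.
Proof.
move=> [N [mN N0 NQ]].
have mRN : measurable (sfs_ran s i `&` phi i @^-1` N).
  by case: (phiP i) => -[mphi _ _] _; exact: mphi.
have RNR : sfs_ran s i `&` phi i @^-1` N `<=` sfs_ran s i by move=> x [].
exists (sfs_ran s i `&` phi i @^-1` N); split => //.
  apply/(phi0 mRN RNR); apply/eqP; rewrite -measure_le0 -N0.
  rewrite le_measure// ?inE//; first exact: mphi_image.
  by move=> _ [x [_ Nx] <-].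
by move=> x /not_implyP[Rx Qx]; split => //; exact: NQ.
Qed.

Let glue (x : X) : X' :=
  if [pick j | x \in sfs_ran s j] is Some j then phi j x else point.

Let glueE x j : (forall k, sfs_ran s k x <-> k = j) -> glue x = phi j x.
Proof.
move=> jP; rewrite /glue; case: pickP => [k|/(_ j)].
  by rewrite inE => /jP ->.
by rewrite mem_set//; exact/jP.
Qed.

Lemma glued_weighted_iso : exists E F Theta psi w,
  [/\ weighted_iso m m' E F Theta psi w,
      {ae m, forall x, E x}, {ae m', forall y, F y},
      {ae m, forall x, forall j, sfs_ran s j x -> Theta x = phi j x} &
      {ae m, forall x, forall j, sfs_ran s j x <-> sfs_ran s' j (Theta x)}].
Proof.
have /choice[N NP] : forall i, exists N, m.-negligible N /\
    {in sfs_ran s i `\` N &, injective (phi i)}.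
  by move=> i; case: (phiP i) => -[_ [N ? ?] _] _; exists N.
have aeN : {ae m, forall x, forall i, ~ N i x}.
  apply: filter_forall => i; have [[M [mM M0 NM]] _] := NP i.
  by exists M; split => // x /= /contrapT; exact: NM.
have aeR : {ae m, forall x, forall i, sfs_ran s i x -> sfs_ran s' i (phi i x)}.
  apply: filter_forall => i; have [_ phiR] := phiP i.
  have := phi_ae_preimage i phiR.
  by apply: filterS => x h Rx; apply/(h Rx); exists x.
have aeP : {ae m, forall x, forall i, sfs_ran s i x ->
    exists j, forall k, sfs_ran s' k (phi i x) <-> k = j}.
  by apply: filter_forall => i; exact: phi_ae_preimage (sfs_partition sP').
(* The last clause puts the image of a good point of [R_i] in [R'_i] alone, so images of different
   pieces are disjoint and the glued map is injective on the nose. *)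
pose good x := [/\ exists j, forall k, sfs_ran s k x <-> k = j,
  forall i, ~ N i x & forall i, sfs_ran s i x -> forall k,
    sfs_ran s' k (phi i x) <-> k = i].
have : {ae m, forall x, good x}.
  apply: filterS2 (filterI aeR aeP) (filterI aeN (sfs_partition sP)).
  move=> x [Rx Px] [Nx xj]; split => // i Rix.
  have [j jP] := Px i Rix; have /jP ij := Rx i Rix => k.
  by rewrite jP ij.
move=> /ae_measurable_subset[E [mE Eae Egood]].
(* Through this finite union, measurability and nullity of images reduce to the [phi_i]. *)
have glue_img B : B `<=` E -> glue @` B =
    \bigcup_i (phi i @` (B `&` sfs_ran s i)).
  move=> BE; apply/seteqP; split.
    move=> _ [x Bx <-]; have [[j jP] _ _] := Egood _ (BE _ Bx).
    by exists j => //; exists x; [split => //; exact/jP|rewrite (glueE jP)].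
  move=> _ [i _ [x [Bx Rx] <-]]; exists x => //.
  have [[j jP] _ _] := Egood _ (BE _ Bx).
  by rewrite (glueE jP) -((jP i).1 Rx).
have mglue : measurable_fun E glue.
  move=> _ B mB.
  have -> : E `&` glue @^-1` B =
      \bigcup_i (E `&` (sfs_ran s i `&` phi i @^-1` B)).
    apply/seteqP; split.
      move=> x [Ex Bx]; have [[j jP] _ _] := Egood _ Ex; exists j => //.
      by split => //; split; [exact/jP|rewrite /= -(glueE jP)].
    move=> x [i _ [Ex [Rx Bx]]]; split => //; have [[j jP] _ _] := Egood _ Ex.
    by rewrite /= (glueE jP) -((jP i).1 Rx).
  apply: fin_bigcup_measurable => [|i _]; first exact: finite_finset.
  by apply: measurableI => //; case: (phiP i) => -[mphi _ _] _; exact: mphi.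
have injglue : {in E &, injective glue}.
  move=> x y; rewrite !inE => Ex Ey.
  have [[j jP] Nx xk] := Egood _ Ex; have [[k kP] Ny yk] := Egood _ Ey.
  rewrite (glueE jP) (glueE kP) => xy.
  have Rx : sfs_ran s j x by exact/jP.
  have Ry : sfs_ran s k y by exact/kP.
  have jk : j = k by apply/(yk k Ry); rewrite -xy; apply/(xk j Rx).
  rewrite -jk in xy Ry; have [_ inj] := NP j.
  by apply: inj xy; rewrite inE; split.
have mimg B : measurable B -> B `<=` E -> measurable (glue @` B).
  move=> mB /glue_img ->; apply: fin_bigcup_measurable => [|i _].
    exact: finite_finset.
  by apply: mphi_image => [|x []//]; exact: measurableI.
have null_img B : measurable B -> B `<=` E ->
    m' (glue @` B) = 0%E <-> m B = 0%E.
  move=> mB BE; have mBR i := measurableI _ _ mB (mR i).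
  have BRR i : B `&` sfs_ran s i `<=` sfs_ran s i by move=> x [].
  split => B0.
    apply/(ae_measure_eq0 m mB).
    have : {ae m, forall x, forall i, ~ (B `&` sfs_ran s i) x}.
      apply: filter_forall => i; apply/(ae_measure_eq0 m (mBR i)).
      apply/(phi0 (mBR i) (@BRR i)); apply/eqP; rewrite -measure_le0 -B0.
      rewrite le_measure ?inE//; [exact: mphi_image|exact: mimg|].
      by rewrite glue_img// => y ?; exists i.
    apply: filterS => x Bx0 Bx; have [[j jP] _ _] := Egood _ (BE _ Bx).
    by apply: (Bx0 j); split => //; exact/jP.
  apply/(ae_measure_eq0 m' (mimg _ mB BE)).
  have : {ae m', forall y, forall i, ~ (phi i @` (B `&` sfs_ran s i)) y}.
    apply: filter_forall => i; apply/(ae_measure_eq0 m').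
      exact: mphi_image.
    apply/(phi0 (mBR i) (@BRR i)); apply/eqP; rewrite -measure_le0 -B0.
    by rewrite le_measure ?inE.
  by apply: filterS => y; rewrite glue_img// => By [i _]; exact: By.
have Fae : {ae m', forall y, (glue @` E) y}.
  have h1 : {ae m', forall y, forall i, (phi i @` sfs_ran s i) y <->
      sfs_ran s' i y} by apply: filter_forall => i; case: (phiP i).
  (* The complement of [E] is null and each [phi_i] maps null sets to null sets. *)
  have h2 : {ae m', forall y, forall i x, sfs_ran s i x -> phi i x = y -> E x}.
    by apply: filter_forall => i; exact: phi_ae_image.
  apply: filterS3 h1 h2 (sfs_partition sP') => y h1 h2 [j jP].
  have [x Rx xy] : (phi j @` sfs_ran s j) y by apply/h1/jP.
  have Ex := h2 j x Rx xy; have [[k kP] _ _] := Egood _ Ex.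
  by exists x => //; rewrite (glueE kP) -((kP j).1 Rx).
have [psi [w I]] := nonsingular_weighted_iso mE mglue injglue mimg null_img Eae Fae.
exists E, (glue @` E), (glue \_ E), psi, w; split => //.
- apply: filterS Eae => x Ex j Rx; rewrite patchE mem_set//.
  by have [[k kP] _ _] := Egood _ Ex; rewrite (glueE kP) -((kP j).1 Rx).
- apply: filterS Eae => x Ex j; rewrite patchE mem_set//.
  have [[k kP] _ xk] := Egood _ Ex; rewrite (glueE kP) kP xk//.
  exact/kP.
Qed.

End gluing.

(** * Conjugation by the glued map and the intertwining unitary *)

Section isomorphic_systems.
Context {R : realType} {L : finType}.
Context {d d' : measure_display} {X : measurableType d} {X' : measurableType d'}.
Variables (m : probability X R) (m' : probability X' R).
Variables (s : sfs_data L X) (s' : sfs_data L X') (A : L -> L -> bool).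
Variables (rho : L -> X -> R) (rho' : L -> X' -> R).
Hypotheses (sP : is_sfs m s) (sP' : is_sfs m' s') (AP : CK_matrix m s A).
Hypothesis rhoP : forall i, is_RN_derivative m s i (rho i).
Hypothesis rhoP' : forall i, is_RN_derivative m' s' i (rho' i).
Variables (phi Phi : L -> X -> X').
Hypothesis Phi_phi : forall i j, A i j ->
  {ae m, forall x, sfs_ran s j x -> Phi i x = phi j x}.
Hypothesis conj_phi : forall i, {ae m, forall x, sfs_dom s i x ->
  sfs_dom s' i (Phi i x) /\ phi i (sfs_map s i x) = sfs_map s' i (Phi i x)}.
Variables (E : set X) (F : set X') (Theta : X -> X') (psi : X' -> X) (w : X -> R).
Hypothesis I : weighted_iso m m' E F Theta psi w.
Hypothesis Eae : {ae m, forall x, E x}.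
Hypothesis Fae : {ae m', forall y, F y}.
Hypothesis Theta_phi : {ae m, forall x, forall j, sfs_ran s j x ->
  Theta x = phi j x}.
Hypothesis Theta_ran : {ae m, forall x, forall j,
  sfs_ran s j x <-> sfs_ran s' j (Theta x)}.

Let J i := sfs_weighted_iso sP rhoP i.
Let J' i := sfs_weighted_iso sP' rhoP' i.

Let tau i : X -> X := sfs_map s i \_ (sfs_dom s i).
Let tau' i : X' -> X' := sfs_map s' i \_ (sfs_dom s' i).

Let psiK : {ae m, forall x, psi (Theta x) = x}.
Proof. by apply: filterS2 Eae (wi_funK I) => x Ex h; case: (h Ex). Qed.

Let ThetaK : {ae m', forall y, Theta (psi y) = y}.
Proof. by apply: filterS2 Fae (wi_invK I) => x Fx h; case: (h Fx). Qed.

Let pull (Q : X' -> Prop) : {ae m', forall y, Q y} ->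
  {ae m, forall x, Q (Theta x)}.
Proof. by move/(wi_ae_fun I); apply: filterS2 Eae => x Ex; exact. Qed.

Let push (P : X -> Prop) : {ae m, forall x, P x} ->
  {ae m', forall y, P (psi y)}.
Proof. by move/(wi_ae_inv I); apply: filterS2 Fae => x Fx; exact. Qed.

Let ran_psi : {ae m', forall y, forall j, sfs_ran s j (psi y) <-> sfs_ran s' j y}.
Proof. by apply: filterS2 (push Theta_ran) ThetaK => y + yK j; rewrite yK; exact. Qed.

(** Condition (C-K) splits [D_i] into pieces [R_j] on which [Phi_i] and [Theta] are both [phi_j]. As
    [sigma_i] is nonsingular, [Theta] is also [phi_i] at [sigma_i x] for almost every [x] in
    [D_i]. *)
Let Theta_conj i : {ae m, forall x, sfs_dom s i x ->
  sfs_dom s' i (Theta x) /\ Theta (tau i x) = sfs_map s' i (Theta x)}.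
Proof.
have PhiTheta : {ae m, forall x, sfs_dom s i x -> Phi i x = Theta x}.
  have h : {ae m, forall x, forall j, A i j -> sfs_ran s j x -> Phi i x = phi j x}.
    apply: filter_forall => j; have [Aij|nAij] := boolP (A i j).
      by apply: filterS (Phi_phi Aij) => x h _.
    exact: aeW.
  have Ai : {ae m, forall x, sfs_dom s i x <->
        (\bigcup_(j in [set j | A i j]) sfs_ran s j) x} := AP i.
  apply: filterS3 Theta_phi h Ai => x Tx hx Aix /Aix [j /= Aij Rx].
  by rewrite (hx j Aij Rx) (Tx j Rx).
have Tran := wi_ae_fun (J i) Theta_phi.
apply: filterS3 PhiTheta Tran (conj_phi i) => x PT TR cp Dx.
have [D'x phix] := cp Dx; rewrite -(PT Dx); split => //.
rewrite -phix /tau patchE mem_set//; have := TR Dx i.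
by rewrite patchE mem_set//; apply; exists x.
Qed.

(* Every point z of R'_i is sigma'_i (Theta u) with u = sigma (psi z) in D_i:
   this is what makes Theta map D_i onto D'_i. *)
Let ran'_coding i : {ae m', forall z, sfs_ran s' i z ->
  let u := sfs_coding s (psi z) in
  [/\ sfs_dom s i u, psi (Theta u) = u & sfs_coding s' z = Theta u]}.
Proof.
pose G x := [/\ psi (Theta x) = x,
  sfs_coding s' (sfs_map s' i (Theta x)) = Theta x &
  Theta (tau i x) = sfs_map s' i (Theta x)].
have Gae : {ae m, forall x, sfs_dom s i x -> G x}.
  apply: filterS3 psiK (Theta_conj i) (pull (sfs_codingK sP' i)).
  by move=> x px Tx cx Dx; have [D'x e] := Tx Dx; split => //; exact: cx.
have K : {ae m, forall v, sfs_ran s i v -> let u := sfs_coding s v in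
    [/\ sfs_dom s i u, G u & tau i u = v]}.
  apply: filterS2 (wi_ae_inv (J i) Gae) (wi_invK (J i)) => v Gv Kv Rv.
  by have [Du tu] := Kv Rv; split => //; exact: Gv.
apply: filterS3 (push K) ran_psi ThetaK => z Kz Rz Tz R'z.
have /Kz[Du [pu cu Tu] tu] : sfs_ran s i (psi z) by exact/Rz.
by split => //; rewrite -cu -Tu tu Tz.
Qed.

(** For the converse of [Theta_conj]: if [y] is in [D'_i], then [ran'_coding] at [sigma'_i y] gives
    [u] in [D_i] with [Theta u = y], hence [psi y = u]. *)
Let dom_Theta i : {ae m, forall x, sfs_dom s i x <-> sfs_dom s' i (Theta x)}.
Proof.
have h : {ae m', forall y, sfs_dom s' i y -> sfs_dom s i (psi y)}.
  have := wi_ae_fun (J' i) (ran'_coding i).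
  apply: filterS2 (wi_funK (J' i)) => y K h D'y; have [R'y cy] := K D'y.
  have [Du pu] := h D'y R'y; rewrite cy => yu.
  by rewrite yu pu.
apply: filterS3 (pull h) (Theta_conj i) psiK => x hx Tx px; split.
  by move=> /Tx [].
by rewrite -{2}px.
Qed.

Lemma isomorphic_CK_matrix : CK_matrix m' s' A.
Proof.
move=> i.
have Ai : {ae m, forall x, sfs_dom s i x <->
        (\bigcup_(j in [set j | A i j]) sfs_ran s j) x} := AP i.
have dP := push (dom_Theta i).
have : {ae m', forall y, [/\ sfs_dom s i (psi y) <-> sfs_dom s' i (Theta (psi y)),
    Theta (psi y) = y & sfs_dom s i (psi y) <->
        (\bigcup_(j in [set j | A i j]) sfs_ran s j) (psi y)]}.
  by apply: filterS3 dP ThetaK (push Ai) => y ? ? ?; split.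
apply: filterS2 ran_psi => y Ry [+ yK]; rewrite yK => <- ->.
by split => -[j Aij] /Ry ?; exists j.
Qed.

(** The two factorisations of the map from [D_i] to [R'_i] have inverses [sigma o psi] and
    [psi o sigma'], which agree a.e. on [R'_i] by [ran'_coding]; hence the squares agree, and the
    weights are nonnegative a.e. on [D_i]. *)
Let weightE i : {ae m, forall x, sfs_dom s i x ->
  rho i x `^ 2^-1 * w (tau i x) = w x * rho' i (Theta x) `^ 2^-1}.
Proof.
have mR := sfs_measurable_ran sP i; have mR' := sfs_measurable_ran sP' i.
have mD := sfs_measurable_dom sP i; have mD' := sfs_measurable_dom sP' i.
(* [Theta] is cut down to [R_i] so that [sigma_i] followed by it ends in [R'_i]. *)
have Iran : weighted_iso m m' (E `&` sfs_ran s i) (F `&` sfs_ran s' i) Theta psi w.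
  apply: (weighted_iso_restrict I) => //.
  by apply: filterS Theta_ran => x + _; exact.
have mw : measurable_fun setT w := wi_weight I.
have mTheta := wi_fun I; have mpsi := wi_inv I.
have mrho (r : R) : measurable_fun setT (@powR R ^~ r) by exact: measurable_powR.
have [mri _] := rhoP i; have [mri' _] := rhoP' i.
have ran_sub : {ae m, forall y, (E `&` sfs_ran s i) y -> sfs_ran s i y}.
  by apply: aeW => y [].
have cod_sub : {ae m', forall y, sfs_dom s' i y -> F y}.
  by apply: filterS Fae.
have dom1 : {ae m, forall x, sfs_dom s i x <->
    sfs_dom s i x /\ (E `&` sfs_ran s i) (tau i x)}.
  apply: filterS2 (wi_ae_fun (J i) Eae) (wi_funK (J i)) => x ETx Kx.
  split => [Dx|[]//]; split => //; split; first exact: ETx.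
  by have [] := Kx Dx.
have dom2 : {ae m, forall x, sfs_dom s i x <-> E x /\ sfs_dom s' i (Theta x)}.
  by apply: filterS2 Eae (dom_Theta i) => x Ex ->; split => [|[]].
have cov1 := weighted_iso_comp_cov (J i) Iran ran_sub mD dom1.
have cov2 := weighted_iso_comp_cov I (J' i) cod_sub mD dom2.
have mtheta1 : measurable_fun setT (sfs_coding s \o psi).
  exact: measurableT_comp (sfs_measurable_coding sP) mpsi.
have mtheta2 : measurable_fun setT (psi \o sfs_coding s').
  exact: measurableT_comp mpsi (sfs_measurable_coding sP').
have cov1' B : measurable B ->
    m' (sfs_ran s' i `&` (sfs_coding s \o psi) @^-1` B) =
    (\int[m]_(x in sfs_dom s i `&` B) ((rho i x `^ 2^-1 * w (tau i x)) ^+ 2)%:E)%E.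
  move=> mB; rewrite -cov1//.
  have mpre : measurable ((sfs_coding s \o psi) @^-1` B).
    by rewrite -[X in measurable X]setTI; exact: mtheta1.
  apply: ae_eq_measure.
  - exact: measurableI.
  - by apply: measurableI => //; apply: measurableI => //; exact: (wi_cod I).
  - by apply: filterS Fae => y Fy; split => [[Ry By]|[[_ Ry] By]].
have : {ae m, forall x, sfs_dom s i x ->
    (rho i x `^ 2^-1 * w (tau i x)) ^+ 2 =
    (w x * rho' i (Theta x) `^ 2^-1) ^+ 2}.
  apply: (weighted_iso_weight_unique mD _ _ _ mR' mtheta1 mtheta2 _ cov1' cov2).
  - apply: measurable_funM; first exact: (measurableT_comp (mrho _)).
    exact: (measurableT_comp mw (wi_fun (J i))).
  - apply: measurable_funM => //.
    apply: (measurableT_comp (mrho _)).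
    exact: (measurableT_comp mri').
  - by apply: le_lt_trans (probability_le1 m' mR') _; rewrite ltry.
  - apply: filterS (ran'_coding i) => z Kz Rz; have [_ pu cz] := Kz Rz.
    by rewrite /= cz pu.
have w0 : {ae m, forall x, 0 < w x}.
  by apply: filterS2 Eae (wi_gt0 I) => x Ex; exact.
apply: filterS3 w0 (wi_ae_fun (J i) w0) => x w0 wT e Dx.
apply/eqP; rewrite -(@eqrXn2 _ 2) ?mulr_ge0 ?powR_ge0 ?(ltW w0)//.
  exact/eqP/e.
exact/ltW/wT.
Qed.

Definition intertwiner : L2 m' -> L2 m := weighted_op m m' E Theta w.

Lemma intertwiner_costar i xi :
  sfs_costar s rho i (intertwiner xi) = intertwiner (sfs_costar s' rho' i xi).
Proof.
apply/L2P.
have h1 := weighted_op_ae (J i) (weighted_opE I xi).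
have h2 := weighted_op_ae I (weighted_opE (J' i) xi).
have h3 : {ae m, forall x,
  weighted_comp (sfs_dom s i) (fun x => rho i x `^ 2^-1) (tau i)
    (weighted_comp E w Theta (L2_to_fun xi)) x =
  weighted_comp E w Theta
    (weighted_comp (sfs_dom s' i) (fun y => rho' i y `^ 2^-1) (tau' i)
      (L2_to_fun xi)) x}.
  have ET := wi_ae_fun (J i) Eae.
  have DWT : {ae m, forall x, [/\ sfs_dom s i x <-> sfs_dom s' i (Theta x),
      sfs_dom s i x ->
        rho i x `^ 2^-1 * w (tau i x) = w x * rho' i (Theta x) `^ 2^-1 &
      sfs_dom s i x ->
        sfs_dom s' i (Theta x) /\ Theta (tau i x) = sfs_map s' i (Theta x)]}.
    by apply: filterS3 (dom_Theta i) (weightE i) (Theta_conj i) => x ? ? ?.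
  apply: filterS3 Eae ET DWT => x Ex ETx [DT wx Tx].
  rewrite /weighted_comp !indicE (mem_set Ex) mul1r.
  have -> : (Theta x \in sfs_dom s' i) = (x \in sfs_dom s i).
    by apply/idP/idP; rewrite !inE => /DT.
  case: (asboolP (sfs_dom s i x)) => [Dx|nDx]; last first.
    rewrite (_ : (x \in _) = false) ?mul0r ?mulr0//.
    by apply/negbTE; rewrite notin_setE.
  rewrite (mem_set Dx) (mem_set (ETx Dx)) !mul1r !mulrA -!rmorphM /= wx//.
  congr (_ * L2_to_fun _ _); have [D'x ->] := Tx Dx.
  by rewrite /tau' patchE mem_set.
by apply: filterS3 h1 h2 h3 => x -> -> ->.
Qed.

(** Isometry holds because [F] is conull, surjectivity because [E] is. *)
Lemma intertwiner_unitary :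
  unitary_operator (@L2_ip _ _ _ m) (@L2_ip _ _ _ m') intertwiner.
Proof.
split; first exact: (weighted_op_linear I).
  by move=> f g; exact: (weighted_op_ip I).
move=> h; exists (weighted_op m' m F psi (fun y => w (psi y) `^ (- 1)) h).
apply/L2P; apply: filterS2 Eae (weighted_opK I h) => x Ex ->.
by rewrite indicE mem_set// rmorph1 mul1r.
Qed.

(** Every vector is some [U eta]; against it, moving both operators to the right as adjoints reduces
    the identity to [intertwiner_costar]. *)
Lemma intertwiner_operator i xi :
  intertwiner (sfs_operator s' rho' i xi) = sfs_operator s rho i (intertwiner xi).
Proof.
have ipP := L2_ip_semi m; have ipP' := L2_ip_semi m'.
apply/eqP; rewrite -subr_eq0; apply/eqP.
apply: (ip_nondegenerate (@L2_ip_definite _ _ _ m)) => g.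
have [_ Uip Us] := intertwiner_unitary; have [eta <-] := Us g.
rewrite (semi_ipBl ipP) Uip (sfs_operator_adjoint sP' rhoP').
by rewrite (sfs_operator_adjoint sP rhoP) intertwiner_costar Uip subrr.
Qed.

End isomorphic_systems.

Theorem theorem3p4 (R : realType) (L : finType)
    (d d' : measure_display) (X : measurableType d) (X' : measurableType d')
    (m : probability X R) (m' : probability X' R)
    (s : sfs_data L X) (s' : sfs_data L X')
    (A : L -> L -> bool)
    (rho : L -> X -> R) (rho' : L -> X' -> R) :
  nonatomic m -> nonatomic m' ->
  is_sfs m s -> is_sfs m' s' ->
  saturated m s -> saturated m' s' ->
  CK_matrix m s A -> condition_CK m' s' ->
  isomorphic_sfs m m' s s' A ->
  (forall i, is_RN_derivative m s i (rho i)) ->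
  (forall i, is_RN_derivative m' s' i (rho' i)) ->
  let T : L -> L2 m -> L2 m := sfs_operator s rho in
  let T' : L -> L2 m' -> L2 m' := sfs_operator s' rho' in
  (* T and T' act by the formulas and satisfy the relations of A, which is
     also a matrix for s' *)
  (forall i psi, {ae m, forall x,
     L2_to_fun (T i psi) x = sfs_operator_fun s rho i (L2_to_fun psi) x}) /\
  (forall i xi, {ae m', forall x,
     L2_to_fun (T' i xi) x = sfs_operator_fun s' rho' i (L2_to_fun xi) x}) /\
  CK_matrix m' s' A /\
  CK_operators A (@L2_ip _ _ _ m) T /\
  CK_operators A (@L2_ip _ _ _ m') T' /\
  (* unitary equivalence, on generators and on the whole algebra *)
  exists U : L2 m' -> L2 m,
    unitary_operator (@L2_ip _ _ _ m) (@L2_ip _ _ _ m') U /\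
    (forall i xi, U (T' i xi) = T i (U xi)) /\
    (forall (O : cstarAlgebra R) (S : L -> O), is_CK_algebra A S ->
      forall (pi : O -> L2 m -> L2 m) (pi' : O -> L2 m' -> L2 m'),
      is_representation (@L2_ip _ _ _ m) pi ->
      is_representation (@L2_ip _ _ _ m') pi' ->
      (forall i, pi (S i) = T i) -> (forall i, pi' (S i) = T' i) ->
      forall a xi, U (pi' a xi) = pi a (U xi)).
Proof.
move=> _ _ sP sP' _ _ AP _ [phi [Phi [phiP phi0 Phi_phi conj_phi]]] rhoP rhoP' T T'.
have [E [F [theta [psi [w [I Eae Fae Theta_phi Theta_ran]]]]]] :=
  glued_weighted_iso sP sP' phiP phi0.
have AP' : CK_matrix m' s' A := isomorphic_CK_matrix sP sP' AP rhoP rhoP'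
  Phi_phi conj_phi I Eae Fae Theta_phi Theta_ran.
have unitaryU := intertwiner_unitary I Eae Fae.
have UT := intertwiner_operator sP sP' AP rhoP rhoP' Phi_phi conj_phi I Eae Fae
  Theta_phi Theta_ran.
split; first by move=> i f; exact: sfs_operator_ae.
split; first by move=> i f; exact: sfs_operator_ae.
split=> //; split; first exact: sfs_CK_operators.
split; first exact: sfs_CK_operators.
exists (intertwiner m E theta w); split=> //; split=> //.
move=> O S OS pi pi' piP piP' piS piS'.
apply: (intertwine_CK_algebra (L2_ip_semi m) (L2_ip_semi m')
  (@L2_ip_definite _ _ _ m) piP piP' unitaryU OS).
by move=> i xi; rewrite piS piS'; exact: UT.
Qed.
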